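(* Let $b\ge2$ be an integer, let $G=\bigoplus_{i\in\mathbb{N}}\mathbb{Z}_b$, and let $\mu(y)=b^{-2\ell(y)}f(\ell(y))$ for $y\in G$, where $f:[0,\infty)\to[0,\infty)$ is an increasing function (such that $\mu$ is a finite measure whose support generates $G$). Then the percolation model $G_\mu(\lambda)$ satisfies: (a) $\lambda_{\mathrm c}(\mu)<\infty$ if $f(\ell)=\Omega\bigl(a^{\sqrt{\ell}}\bigr)$ as $\ell\to\infty$ for some $a>1$; (b) $\lambda_{\mathrm c}(\mu)=\infty$ if $f(\ell)=o(\log\ell)$ as $\ell\to\infty$ and $f$ is ultimately concave (i.e. concave on $[\ell_0,\infty)$ for some $\ell_0$).
   Context: $G=\bigoplus_{i\in\mathbb{N}}\mathbb{Z}_b$ is the group of all sequences $(y^{(1)},y^{(2)},\dots)$ of elements of $\mathbb{Z}_b=\mathbb{Z}/b\mathbb{Z}$ with only finitely many non-zero terms, under componentwise addition. For $y\in G$, $\ell(y)$ is the position of the last non-zero term of $y$, with $\ell(\mathbf 0)=0$. For a finite symmetric measure $\mu$ on $G$ whose support generates $G$ (not necessarily normalised to be a probability measure) and $\lambda>0$, $G_\mu(\lambda)$ is the random multigraph with vertex set $G$ in which, independently for each unordered pair of distinct elements $g,h\in G$, the number of parallel edges between $g$ and $h$ is a Poisson random variable with mean $\lambda\,\mu(g^{-1}h)$ (here $g^{-1}h=h-g$). The percolation threshold is $$\lambda_{\mathrm c}(\mu)=\sup\{\lambda : \mathbb{P}(G_\mu(\lambda)\text{ has an infinite component})=0\}\in[0,\infty].$$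 $f(x)=\Omega(g(x))$ means $\liminf_{x\to\infty}f(x)/g(x)>0$; $f(x)=o(g(x))$ means $\lim_{x\to\infty}f(x)/g(x)=0$. *)

(* Defs.v *)
From HB Require Import structures.
From mathcomp Require Import all_boot all_order all_algebra.
From mathcomp Require Import finmap.
From mathcomp Require Import all_classical all_reals all_analysis.

Set Implicit Arguments.
Unset Strict Implicit.
Unset Printing Implicit Defensive.

Import Order.TTheory GRing.Theory Num.Theory.
Import numFieldNormedType.Exports.

Local Open Scope classical_set_scope.
Local Open Scope ring_scope.

Definition is_Omega (R : realType) (f g : R -> R) : Prop :=
  (0 < limf_einf (fun x => (f x / g x)%:E) (pinfty_nbhs R))%E.

Definition is_little_o (R : realType) (f g : R -> R) : Prop :=
  f x / g x @[x --> +oo] --> (0 : R).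

Definition ultimately_concave (R : realType) (f : R -> R) : Prop :=
  exists2 l0 : R, 0 <= l0 &
    @convex_function R R^o [set x | l0 <= x] (fun x => - f x).

(* An element of {poly A} is a sequence of coefficients with finitely many
   nonzero terms, so the additive group of {poly 'Z_b} is the direct sum of
   copies of Z/bZ indexed by the positive integers: the i-th term of y is the
   coefficient y`_(i.-1).  ('Z_b is Z/bZ only when 1 < b.) *)
Definition Zb_sum (b : nat) : countZmodType := {poly 'Z_b}.

Definition ell (b : nat) (y : Zb_sum b) : nat := size (y : {poly 'Z_b}).

Lemma ell0 (b : nat) : ell (0 : Zb_sum b) = 0%N.
Proof. exact: size_poly0. Qed.

Lemma ellP (b n : nat) (y : Zb_sum b) :
  ell y = n.+1 <->
  (y : {poly 'Z_b})`_n != 0 /\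
  (forall m : nat, (n < m)%N -> (y : {poly 'Z_b})`_m = 0).
Proof.
rewrite /ell; split=> [sy|[yn0 y0]].
  split=> [|m nm]; last by rewrite nth_default // sy.
  have := lead_coef_eq0 (y : {poly 'Z_b}).
  by rewrite /lead_coef sy -size_poly_eq0 sy => ->.
apply/eqP; rewrite eqn_leq; apply/andP; split; first exact/leq_sizeP.
by rewrite ltnNge; apply: contraNN yn0 => sy; rewrite nth_default.
Qed.

Definition level_measure (R : realType) (b : nat) (f : R -> R)
    (y : Zb_sum b) : R :=
  b%:R ^- (2 * ell y) * f (ell y)%:R.

Lemma level_measure_sym (R : realType) (b : nat) (f : R -> R)
    (y : Zb_sum b) : level_measure f (- y) = level_measure f y.
Proof. by rewrite /level_measure /ell size_polyN. Qed.

(* A measure on a countable group is given by its point masses. *)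
Definition finite_mass (R : realType) (G : countZmodType) (mu : G -> R) : Prop :=
  (\esum_(y in [set: G]) (mu y)%:E < +oo)%E.

Definition support_generates (R : realType) (G : countZmodType)
    (mu : G -> R) : Prop :=
  forall H : {pred G}, zmod_closed H ->
    (forall y, mu y != 0 -> y \in H) -> forall y, y \in H.

Definition mutually_independent (d : measure_display) (T : measurableType d)
    (R : realType) (P : probability T R) (I : choiceType) (D : set I)
    (X : I -> {RV P >-> nat}) : Prop :=
  forall (J : {fset I}) (A : I -> set nat), [set` J] `<=` D ->
    (P (\bigcap_(i in [set` J]) (X i @^-1` A i)) =
     \prod_(i <- J) P (X i @^-1` A i))%E.

(* N e is the number of parallel edges joining the two elements of e; only the
   values at two-element sets e matter.  The second argument of poisson_prob
   is a dummy, and poisson_prob 0 is the Dirac mass at 0. *)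
Record is_poisson_multigraph (d : measure_display) (T : measurableType d)
    (R : realType) (P : probability T R) (G : countZmodType)
    (mu : G -> R) (lam : R) (N : {fset G} -> {RV P >-> nat}) : Prop := {
  edge_law : forall (g h : G), g != h -> forall A : set nat,
    distribution P (N [fset g; h]%fset) A = poisson_prob (lam * mu (h - g)) 0 A;
  edge_independent :
    mutually_independent [set e : {fset G} | #|` e|%fset = 2%N] N
}.

Definition adjacent (G : choiceType) (n : {fset G} -> nat) : rel G :=
  fun g h => (g != h) && (0 < n [fset g; h]%fset)%N.

Definition component (G : choiceType) (n : {fset G} -> nat) (g : G) : set G :=
  [set h | exists2 p : seq G, path (adjacent n) g p & last g p = h].

Definition has_infinite_component (G : choiceType) (n : {fset G} -> nat) : Prop :=
  exists g : G, infinite_set (component n g).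

(* Whether P(infinite component) = 0 depends only on mu and lam, since they
   determine the joint law of the edge multiplicities; hence the quantification
   over all realisations of the random multigraph. *)
Definition as_no_infinite_component (R : realType) (G : countZmodType)
    (mu : G -> R) (lam : R) : Prop :=
  forall (d : measure_display) (T : measurableType d) (P : probability T R)
    (N : {fset G} -> {RV P >-> nat}),
    is_poisson_multigraph mu lam N ->
    P [set w | has_infinite_component (fun e => N e w)] = 0%E.

(* The threshold lies in [0, +oo]; the maximum with 0 gives sup set0 = 0. *)
Definition lambda_c (R : realType) (G : countZmodType) (mu : G -> R) : \bar R :=
  Order.max 0%E (ereal_sup
    [set lam%:E | lam in [set lam : R | 0 < lam /\
                                        as_no_infinite_component mu lam]]).

(* Main.v *)
(* (b) For every e > 0 there is C with f <= e ln + C on [1, +oo[.  Let B_k be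
   the ball of radius 2 k^2.  The mean number of edges from B_k to
   B_(k+1) \ B_k is at most lam f(2 (k+1)^2), hence at most ln (k+1) + C', so
   these edges are all absent with probability at least c / (k+1).  As k varies
   these events are independent and their probabilities have a divergent sum.
   The edges leaping from B_k to the complement of B_(k+1) are exponentially
   unlikely.  Hence almost surely infinitely many of the B_k are isolated, and
   every component is finite.

   (a) Merge N_j = b ^ k_j blocks (cosets of a ball) of scale j into one block
   of scale j + 1, with k_j of order 2 log_b j.  Such a block is good when at
   most one of its sub-blocks is bad and the clusters of the good sub-blocks are
   pairwise adjacent; its cluster is then the union of theirs, and fills a
   proportion at least 1/2 of the block, up to a constant factor.  Two clusters
   of scale j fail to be adjacent with probability at most
   exp (- lam kappa N_j^2) since f (n) grows faster than n^8, so the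
   probability p_j of being bad satisfies
   p_(j+1) <= N_j^2 (p_j^2 + exp (- lam kappa N_j^2)), and p_j = O (N_j^-4) by
   induction for lam large.  With positive probability all the blocks around 0
   are good, and their clusters form an infinite connected set. *)
From HB Require Import structures.
Require Import Defs.
From mathcomp Require Import all_boot all_order all_algebra.
From mathcomp Require Import finmap.
From mathcomp Require Import all_classical all_reals all_analysis.
From mathcomp Require Import measurable_realfun ring lra zify.

Set Implicit Arguments.
Unset Strict Implicit.
Unset Printing Implicit Defensive.

Import Order.TTheory GRing.Theory Num.Theory.
Import numFieldNormedType.Exports.

Local Open Scope classical_set_scope.
Local Open Scope ring_scope.

(** * Realisations of the Poisson multigraph *)

(** The pushforward of Lebesgue measure by the affine map, divided by [s], agrees with it on
    half-open intervals, hence everywhere by uniqueness. *)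
Lemma lebesgue_measure_affine (R : realType) (c s : R) (B : set R) :
  0 < s -> measurable B ->
  lebesgue_measure ((fun u : R => (u - c) / s) @^-1` B) =
  (s%:E * lebesgue_measure B)%E.
Proof.
move=> s0 mB.
pose f (u : measurableTypeR R) : measurableTypeR R := (u - c) / s.
have mf : measurable_fun [set: measurableTypeR R] f.
  by apply: measurable_funM => //; apply: measurable_funB.
have si : 0 <= s^-1 by rewrite invr_ge0 ltW.
pose nu_of : {measure set (measurableTypeR R) -> \bar R} :=
  mscale (NngNum si) (pushforward lebesgue_measure f).
pose nu := nu_of mf.
have -> : lebesgue_measure B = nu B.
  apply: lebesgue_measure_unique => // _ [[x y]] _ <-.
  rewrite /nu /nu_of /mscale/= /pushforward.
  change (lebesgue_measure (`]x, y] : set R) =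
    ((s^-1)%:E * lebesgue_measure (f @^-1` `]x, y]))%E).
  have -> : f @^-1` `]x, y]%classic = `](c + s * x), (c + s * y)]%classic.
    apply/seteqP; split=> u /=; rewrite !in_itv/= ltr_pdivlMr// ler_pdivrMr//.
      by rewrite !(mulrC s); move=> /andP[? ?]; apply/andP; split; lra.
    by rewrite !(mulrC s); move=> /andP[? ?]; apply/andP; split; lra.
  rewrite !lebesgue_measure_itv/= !lte_fin ltrD2l ltr_pM2l//.
  case: ifP => _; last by rewrite mule0.
  by rewrite -!EFinB -EFinM; congr EFin; field; rewrite gt_eqF.
by rewrite /nu /nu_of /mscale/= muleA -EFinM mulfV ?gt_eqF// mul1e.
Qed.

(** The null endpoint 1 is dropped because the quantile intervals only cover [[0, 1[]. *)
Lemma uniform01_probE (R : realType) (A : set R) : measurable A ->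
  uniform_prob (@ltr01 R) A = lebesgue_measure (A `&` `[0, 1[%classic).
Proof.
move=> mA; rewrite /uniform_prob integral_uniform_pdf.
rewrite (eq_integral (fun=> 1%E)); last first.
  move=> x; rewrite inE => -[_]; rewrite /= in_itv/= /uniform_pdf => ->.
  by rewrite subr0 invr1.
rewrite integral_cst//=; last exact: measurableI.
rewrite mul1e -(@setDUK _ [set (1 : R)] `[0, 1]%classic); last first.
  by move=> _ ->/=; rewrite in_itv/= ler01 lexx.
rewrite setIUr measureU//=.
- rewrite (_ : lebesgue_measure (A `&` [set (1 : R)%R]) = 0)%E ?add0e; last first.
    apply/eqP; rewrite -measure_le0 -(lebesgue_measure_set1 (1 : R)).
    by apply: le_measure; rewrite ?inE//; exact: measurableI.
  congr (lebesgue_measure (A `&` _)); apply/seteqP; split=> x/=.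
    rewrite !in_itv/= => -[/andP[-> x1] /eqP x1']; rewrite lt_neqAle x1.
    by rewrite x1'.
  rewrite !in_itv/= => /andP[-> x1]; rewrite ltW//; split=> //.
  by move=> xE; rewrite xE ltxx in x1.
- exact: measurableI.
- by apply: measurableI => //; apply: measurableD.
- by apply/seteqP; split=> // x [[_ /= ->]] [_ []] /=.
Qed.

Lemma measurable_nat_valued d (T : measurableType d) (N : T -> nat) :
  (forall k, measurable (N @^-1` [set k])) -> measurable_fun [set: T] N.
Proof.
move=> mN _ Y _; rewrite setTI.
have -> : N @^-1` Y = \bigcup_(k in Y) N @^-1` [set k].
  by apply/seteqP; split=> [u Yu|u [k Yk] /= ->//]; exists (N u).
by apply: bigcup_measurable.
Qed.

(** * Sampling a law on the integers from a uniform variable *)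

Section quantile.
Context {R : realType}.
Variable (c : nat -> R).
Hypotheses (c0 : c 0%N = 0) (c_ndecr : {homo c : i j / (i <= j)%N >-> i <= j}).
Hypothesis (c1 : c n @[n --> \oo] --> (1 : R)).

(** Meant for [c k] the mass of the integers below [k]. The default 0 is taken only outside [[0,
    1[]. *)
Definition quantile (u : R) : nat := xget 0%N [set k | c k <= u < c k.+1].

Definition residue (u : R) : R :=
  (u - c (quantile u)) / (c (quantile u).+1 - c (quantile u)).

Lemma quantileE u k : c k <= u < c k.+1 -> quantile u = k.
Proof.
move=> /andP[ku uk]; rewrite /quantile; case: xgetP => [l _ /andP[lu ul]|]; last first.
  by move=> /(_ k) []; apply/andP.
apply/eqP; rewrite eqn_leq; apply/andP; split; rewrite leqNgt; apply/negP => /c_ndecr h.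
  by have := lt_le_trans uk (le_trans h lu); rewrite ltxx.
by have := lt_le_trans ul (le_trans h ku); rewrite ltxx.
Qed.

Lemma quantile_mem u : 0 <= u < 1 -> c (quantile u) <= u < c (quantile u).+1.
Proof.
move=> /andP[u0 u1].
have ex : exists k, u < c k.
  have := @cvgr_gt _ _ _ _ _ _ c1 u u1.
  by move=> [n _ /(_ n (leqnn n))]; exists n.
case: (ex_minnP ex) => -[|m] um mmin; first by move: um; rewrite c0 ltNge u0.
rewrite (@quantileE _ m) um andbT leNgt;
  by apply/negP => /mmin; rewrite ltnn.
Qed.

Lemma measurable_quantile_eq k : measurable (quantile @^-1` [set k]).
Proof.
pose I k := `[c k, c k.+1[%classic.
have mI j : measurable (I j) by exact: measurable_itv.
(* Points in no interval take the default value, so they join the preimage of 0. *)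
have -> : quantile @^-1` [set k] =
    I k `|` (if k == 0%N then ~` (\bigcup_j I j) else set0).
  apply/seteqP; split=> [u /= uk|u [/=|]].
  - have [[j _ Iju]|nI] := pselect ((\bigcup_j I j) u).
      left; rewrite -uk; move: Iju.
      by rewrite /I/= !in_itv/= => /[dup] /quantileE ->.
    right; suff -> : k == 0%N by [].
    rewrite -uk /quantile; case: xgetP => // j _ ju.
    by exfalso; apply: nI; exists j => //; rewrite /I/= in_itv.
  - by rewrite /I/= in_itv/= => /quantileE ->.
  - case: eqP => [-> /= nI|//]; rewrite /quantile; case: xgetP => // j _ ju.
    by exfalso; apply: nI; exists j => //; rewrite /I/= in_itv.
apply: measurableU => //; case: ifP => // _.
by apply: measurableC; exact: bigcup_measurable.
Qed.

Lemma measurable_quantile : measurable_fun [set: R] quantile.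
Proof. by apply: measurable_nat_valued; exact: measurable_quantile_eq. Qed.

Lemma measurable_residue : measurable_fun [set: R] residue.
Proof.
move=> _ B mB; rewrite setTI.
pose a k := fun u : R => (u - c k) / (c k.+1 - c k).
have -> : residue @^-1` B = \bigcup_k (quantile @^-1` [set k] `&` a k @^-1` B).
  apply/seteqP; split=> [u Bu|u [k _ [/= <-]]]//.
  by exists (quantile u).
apply: bigcup_measurable => k _; apply: measurableI.
  exact: measurable_quantile_eq.
rewrite -[X in measurable X]setTI.
suff : measurable_fun setT (a k) by apply.
by apply: measurable_funM => //; apply: measurable_funB.
Qed.

(** On [[c k, c k.+1[] the residue is the increasing affine map onto [[0, 1[], so preimages are
    scaled by the length of the interval. *)
Lemma quantile_residue k B : measurable B ->
  uniform_prob (@ltr01 R) (quantile @^-1` [set k] `&` residue @^-1` B) =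
  ((c k.+1 - c k)%:E * uniform_prob (@ltr01 R) B)%E.
Proof.
move=> mB.
have mr : measurable (residue @^-1` B).
  by rewrite -[X in measurable X]setTI; exact: measurable_residue.
have mq := measurable_quantile_eq k.
rewrite !uniform01_probE//; last exact: measurableI.
have cc : c k <= c k.+1 by exact: c_ndecr.
have ck0 : 0 <= c k by rewrite -c0; exact: c_ndecr.
have ck1 : c k.+1 <= 1.
  rewrite -(cvg_lim _ c1)//; apply: nondecreasing_cvgn_le => //.
  by apply/cvg_ex; exists 1.
have [ceq|cne] := eqVneq (c k.+1) (c k).
  rewrite ceq subrr mul0e (_ : _ `&` _ = set0) ?measure0//.
  apply/seteqP; split=> // u [[/= qk _]]; rewrite in_itv/= => /quantile_mem.
  by rewrite qk ceq => /andP[h1 h2]; have := le_lt_trans h1 h2; rewrite ltxx.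
have p0 : 0 < c k.+1 - c k by rewrite subr_gt0 lt_neqAle eq_sym cne.
rewrite -(@lebesgue_measure_affine _ (c k))//; last exact: measurableI.
congr lebesgue_measure; apply/seteqP; split=> u /=.
  move=> [[qk]]; rewrite /residue qk => Bu.
  rewrite !in_itv/= => /quantile_mem; rewrite qk => /andP[h1 h2].
  split=> //; apply/andP; split; first by apply: mulr_ge0; [lra|rewrite invr_ge0 ltW].
  by rewrite ltr_pdivrMr// mul1r; lra.
rewrite !in_itv/= pmulr_lge0 ?invr_gt0// ltr_pdivrMr// mul1r => -[Bu /andP[h1 h2]].
have qk : quantile u = k by apply: quantileE; apply/andP; split; lra.
by rewrite /residue qk; split=> //; apply/andP; split; lra.
Qed.

End quantile.

(* The index of the quantile interval containing a uniform variable and the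
   rescaled position inside that interval are independent, and the latter is
   again uniform; so the splitting can be iterated. *)
Lemma split_uniform (R : realType) (nu : probability nat R) :
  exists N S, [/\ measurable_fun [set: R] N, measurable_fun [set: R] S &
    forall (A : set nat) (B : set R), measurable B ->
      uniform_prob (@ltr01 R) (N @^-1` A `&` S @^-1` B) =
      (nu A * uniform_prob (@ltr01 R) B)%E].
Proof.
pose c n := fine (nu [set k | (k < n)%N]).
have cE n : (c n)%:E = nu [set k | (k < n)%N] by rewrite fineK// fin_num_measure.
have c0 : c 0%N = 0.
  by rewrite /c (_ : [set k | _] = set0) ?measure0//; apply/seteqP; split.
have c_ndecr : {homo c : i j / (i <= j)%N >-> i <= j}.
  move=> i j ij; rewrite -lee_fin !cE le_measure ?inE// => k /= ki.
  exact: leq_trans ki ij.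
have c1 : c n @[n --> \oo] --> (1 : R).
  apply: (@fine_cvg _ _ _ _ (fun n => nu [set k | (k < n)%N])).
  rewrite -(@probability_setT _ _ _ nu).
  have -> : [set: nat] = \bigcup_n [set k | (k < n)%N].
    by apply/seteqP; split=> // k _; exists k.+1 => /=.
  apply: nondecreasing_cvg_mu => //.
  by move=> i j ij; apply/subsetPset => k /= ki; exact: leq_trans ki ij.
have pE k : (c k.+1 - c k)%:E = nu [set k].
  rewrite EFinB !cE (_ : [set j | (j < k.+1)%N] = [set j | (j < k)%N] `|` [set k]).
    rewrite measureU//; last first.
      by apply/seteqP; split=> // j [/= jk jE]; rewrite jE ltnn in jk.
    by rewrite addeAC subee ?add0e// fin_num_measure.
  apply/seteqP; split=> j /=; first by rewrite ltnS leq_eqVlt => /orP[/eqP|]; [right|left].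
  by case=> [/ltnW//|->]; rewrite ltnS.
have mq := measurable_quantile c_ndecr.
have mr := measurable_residue c_ndecr.
exists (quantile c), (residue c); split => // A B mB.
pose Q : probability (measurableTypeR R) R := uniform_prob (@ltr01 R).
rewrite -[uniform_prob _]/(Q : set R -> \bar R).
have mP Y : measurable (quantile c @^-1` Y).
  by rewrite -[X in measurable X]setTI; exact: mq.
have mS : measurable (residue c @^-1` B).
  by rewrite -[X in measurable X]setTI; exact: mr.
have -> : quantile c @^-1` A `&` residue c @^-1` B =
    \bigcup_(k in A) (quantile c @^-1` [set k] `&` residue c @^-1` B).
  rewrite -setI_bigcupl; congr (_ `&` _).
  by apply/seteqP; split=> [u Au|u [k Ak /= ->]//]; exists (quantile c u).
rewrite measure_bigcup//=; last 2 first.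
- by move=> k _; exact: (measurableI _ _ (mP [set k]) mS).
- apply/trivIsetP => i j _ _ ij; apply/seteqP; split=> // u [[/= ui _] [/= uj _]].
  by move/eqP: ij; rewrite -ui -uj.
rewrite (eq_eseriesr (g := fun k => (Q B * nu [set k])%E)); last first.
  by move=> k _; rewrite quantile_residue// -pE muleC.
have [q Bq] : exists q, Q B = q%:E.
  by exists (fine (Q B)); rewrite fineK// fin_num_measure.
rewrite Bq nneseriesZl// muleC; congr (_ * _)%E; last by rewrite -Bq.
rewrite -measure_bigcup//=.
  by congr (nu _); apply/seteqP; split=> [k [j Aj ->]//|k Ak]; exists k.
apply/trivIsetP => i j _ _ ij; apply/seteqP; split=> // u [/= ui uj].
by move/eqP: ij; rewrite -ui -uj.
Qed.

(** [N i] reads the i-th value off a uniform variable [V i], and [S i] hands a fresh uniform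
    variable [V i.+1] to the next step. *)
Lemma independent_sequence (R : realType) (nu : nat -> probability nat R) :
  exists X : nat -> measurableTypeR R -> nat,
    (forall i, measurable_fun [set: measurableTypeR R] (X i)) /\
    forall (A : nat -> set nat) n,
      uniform_prob (@ltr01 R) (\bigcap_(i < n) X i @^-1` A i) =
      (\prod_(i < n) nu i (A i))%E.
Proof.
have /choice[N /choice[S NS]] := fun i => split_uniform (nu i).
pose V := fix V i := if i is j.+1 then S j \o V j else @id R.
have mV i : measurable_fun setT (V i).
  elim: i => [|i IH] /=; first exact: measurable_id.
  by apply: measurableT_comp => //; case: (NS i).
have mN i : measurable_fun setT (N i) by case: (NS i).
have mX i : measurable_fun setT (N i \o V i) by exact: measurableT_comp.
exists (fun i => N i \o V i); split=> // A n.
have key m (B : set R) : measurable B ->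
    uniform_prob (@ltr01 R)
      ((\bigcap_(i < m) (N i \o V i) @^-1` A i) `&` V m @^-1` B) =
    ((\prod_(i < m) nu i (A i)) * uniform_prob (@ltr01 R) B)%E.
  elim: m B => [|m IH] B mB.
    rewrite big_ord0 mul1e (_ : \bigcap_(i < 0) _ = setT) ?setTI//.
    by apply/seteqP; split.
  have [_ _ NSm] := NS m.
  rewrite big_ord_recr/= -muleA -NSm// -IH; last first.
    apply: measurableI.
      by rewrite -[X in measurable X]setTI; exact: mN.
    rewrite -[X in measurable X]setTI.
    by have [_ mS _] := NS m; exact: mS.
  congr uniform_prob; apply/seteqP; split=> u /=.
    move=> [h1 h2]; split=> [i im|]; first by apply: h1; exact: ltnW.
    by split=> //; apply: (h1 m) => /=.
  move=> [h1 [h2 h3]]; split=> // i /=.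
  by rewrite ltnS leq_eqVlt => /orP[/eqP->|im] //; apply: h1.
have := key n setT measurableT.
by rewrite preimage_setT setIT probability_setT mule1.
Qed.

(** Finite subsets of a countable group are numbered by [pickle], so one sequence of independent
    variables serves all edges. *)
Lemma exists_poisson_multigraph (R : realType) (G : countZmodType) (mu : G -> R)
    (lam : R) : (forall y, mu (- y) = mu y) ->
  exists (d : measure_display) (T : measurableType d) (P : probability T R)
    (N : {fset G} -> {RV P >-> nat}), is_poisson_multigraph mu lam N.
Proof.
move=> mu_sym.
(* The enumeration of a pair may list it in either order; the symmetry of [mu] makes the rate
   independent of it. *)
pose rate (e : {fset G}) :=
  if enum_fset e is [:: g; h] then lam * mu (h - g) else 0.
have rateE g h : g != h -> rate [fset g; h]%fset = lam * mu (h - g).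
  move=> gh; rewrite /rate.
  have : perm_eq (enum_fset [fset g; h]%fset) [:: g; h].
    apply: uniq_perm; first exact: fset_uniq.
      by rewrite /= inE gh.
    by move=> x; rewrite !inE.
  case: (enum_fset _) => [|x [|y [|z s]]] p; try by have := perm_size p.
  have := perm_mem p x; rewrite !inE eqxx /= => /esym /orP[] /eqP xE.
    have := perm_mem p h; rewrite !inE eqxx orbT xE eq_sym (negPf gh)/=.
    by move=> /eqP ->.
  have := perm_mem p g; rewrite !inE eqxx xE (negPf gh)/= => /eqP ->.
  by rewrite -mu_sym opprB.
pose nu (i : nat) : probability nat R :=
  poisson_prob (oapp rate 0 (choice.unpickle i)) 0%N.
have [X [mX indX]] := independent_sequence nu.
pose Q : probability (measurableTypeR R) R := uniform_prob (@ltr01 R).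
pose N (e : {fset G}) : {RV Q >-> nat} :=
  HB.pack (X (choice.pickle e)) (isMeasurableFun.Build _ _ _ _ (X (choice.pickle e)) (mX _)).
have ind (J : {fset {fset G}}) (A : {fset G} -> set nat) :
    Q (\bigcap_(e in [set` J]) (N e @^-1` A e)) =
    (\prod_(e <- J) nu (choice.pickle e) (A e))%E.
  pose n := (\max_(e <- J) (choice.pickle e).+1)%N.
  have ltn e : e \in J -> (choice.pickle e < n)%N.
    by move=> eJ; rewrite /n (big_fsetD1 e)//= leq_maxl.
  (* Indices that number no member of [J] are left unconstrained. The test on [pickle e] is needed
     because [unpickle] may send several indices to [e]. *)
  pose A' i := if (choice.unpickle i : option {fset G}) is Some e then
    (if (e \in J) && (choice.pickle e == i) then A e else setT) else setT.
  rewrite (_ : \bigcap_(e in _) _ = \bigcap_(i < n) X i @^-1` A' i); last first.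
    apply/seteqP; split=> u /= Hu.
      move=> i _ /=; rewrite /A'; case: (choice.unpickle i) => // e.
      by case: ifPn => // /andP[eJ /eqP <-]; apply: (Hu e).
    move=> e /= eJ; have := Hu _ (ltn e eJ).
    by rewrite /A' /= choice.pickleK eJ eqxx.
  rewrite -[LHS]/(uniform_prob (@ltr01 R) _) indX.
  have <- : (\prod_(i <- [seq choice.pickle e | e <- J]) nu i (A' i) =
             \prod_(e <- J) nu (choice.pickle e) (A e))%E.
    rewrite big_map; apply: eq_big_seq => e eJ.
    by rewrite /A' choice.pickleK eJ eqxx.
  rewrite -(big_mkord xpredT (fun i => nu i (A' i))).
  rewrite (bigID (fun i => i \in [seq choice.pickle e | e <- J]))/=.
  rewrite [X in (_ * X)%E]big1 ?mule1; last first.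
    move=> i iJ; rewrite (_ : A' i = setT); first exact: (probability_setT (nu i)).
    rewrite /A'; case: (choice.unpickle i) => // e; case: ifP => // /andP[eJ /eqP iE].
    by rewrite -iE map_f in iJ.
  rewrite -big_filter; apply: perm_big; apply: uniq_perm.
  - by rewrite filter_uniq// iota_uniq.
  - by rewrite map_inj_uniq ?fset_uniq//; exact: pcan_inj (@choice.pickleK _).
  - move=> i; rewrite mem_filter mem_index_iota /=.
    by case: mapP => // -[e eJ ->]; rewrite ltn.
exists _, (measurableTypeR R), Q, N; split=> [g h gh A|J A _].
  rewrite -rateE//; have := ind [fset [fset g; h]]%fset (fun=> A).
  rewrite big_seq_fset1 /nu choice.pickleK /= => <-.
  rewrite /distribution /pushforward; congr (Q _).
  by apply/seteqP; split=> [u Au e /= /fset1P->|u Hu] //; apply: Hu => /=; rewrite inE.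
rewrite ind; apply: eq_big_seq => e eJ.
have := ind [fset e]%fset A; rewrite big_seq_fset1 => <-; congr (Q _).
by apply/seteqP; split=> [u Hu|u Au e' /= /fset1P->//]; apply: Hu => /=; rewrite inE.
Qed.

(** * Events determined by finitely many edges *)

Section local_events.
Context d (T : measurableType d) (R : realType) (P : probability T R).
Context (I : choiceType) (D : set I) (X : I -> {RV P >-> nat}).
Hypothesis indX : mutually_independent D X.
Implicit Types (J : {fset I}) (E : pred I -> Prop).

Definition positive (w : T) : pred I := fun i => (0 < X i w)%N.

Definition depends_on J E := forall s t : pred I, {in J, s =1 t} -> E s -> E t.

Definition event E : set T := [set w | E (positive w)].

Let cyl J (s : pred I) : set T := [set w | {in J, positive w =1 s}].

Let state (b : bool) : set nat := [set k | (0 < k)%N = b].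

Let cylE J s : cyl J s = \bigcap_(i in [set` J]) (X i @^-1` state (s i)).
Proof. by apply/seteqP; split=> w /= Hw i /= iJ; exact: Hw. Qed.

Let measurable_cyl J s : measurable (cyl J s).
Proof.
rewrite cylE; apply: fin_bigcap_measurable; first exact: finite_fset.
by move=> i _; rewrite -[X in measurable X]setTI; exact: measurable_funPT.
Qed.

Let ofset (S : {fset I}) : pred I := fun i => i \in S.

Let ofset_inj J S S' : S \in fpowerset J -> S' \in fpowerset J ->
  {in J, ofset S =1 ofset S'} -> S = S'.
Proof.
rewrite !fpowersetE => /fsubsetP SJ /fsubsetP S'J SS'; apply/fsetP => i.
have [iJ|iJ] := boolP (i \in J); first exact: SS'.
by rewrite (negPf (contra (SJ i) iJ)) (negPf (contra (S'J i) iJ)).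
Qed.

(** The subsets of [J], read as sets of open indices, list the finitely many configurations on [J];
    their cylinders partition the space. *)
Let partition J (A : set T) : measurable A ->
  P A = (\sum_(S \in [set` fpowerset J]) P (A `&` cyl J (ofset S)))%E.
Proof.
move=> mA; rewrite -measure_fin_bigcup//.
- congr (P _); rewrite -setI_bigcupr -[LHS]setIT; congr (_ `&` _).
  apply/seteqP; split=> // w _.
  exists [fset i in J | positive w i]%fset.
    by rewrite /= fpowersetE; apply/fsubsetP => i; rewrite !inE => /andP[].
  by move=> i iJ; rewrite /ofset !inE /= iJ.
- apply/trivIsetP => S S' /= SJ S'J SS'; apply/seteqP; split=> // w [[_ wS] [_ wS']].
  move/eqP: SS'; apply; apply: (ofset_inj SJ S'J) => i iJ.
  by rewrite -wS// wS'.
- by move=> S _; apply: measurableI.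
Qed.

Lemma measurable_event J E : depends_on J E -> measurable (event E).
Proof.
move=> dE.
rewrite (_ : event E =
  \bigcup_(S in [set S | S \in fpowerset J /\ E (ofset S)]) cyl J (ofset S)).
  apply: fin_bigcup_measurable => //.
  by apply: (@sub_finite_set _ _ [set` fpowerset J]) => // S [].
apply/seteqP; split=> [w Ew|w [S [_ ES] wS]]; last first.
  by apply: dE ES => i iJ; rewrite wS.
have wJ : {in J, positive w =1 ofset [fset i in J | positive w i]%fset}.
  by move=> i iJ; rewrite /ofset !inE /= iJ.
exists [fset i in J | positive w i]%fset => //; split; last exact: dE Ew.
by rewrite fpowersetE; apply/fsubsetP => i; rewrite !inE => /andP[].
Qed.

Let indep_cyl J1 J2 s t : [set` J1] `<=` D -> [set` J2] `<=` D ->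
  [disjoint J1 & J2]%fset ->
  P (cyl J1 s `&` cyl J2 t) = (P (cyl J1 s) * P (cyl J2 t))%E.
Proof.
move=> D1 D2 dJ.
pose A i := if i \in J1 then state (s i) else state (t i).
have J2N i : i \in J2 -> (i \in J1) = false.
  by move=> iJ2; apply/negbTE/negP => iJ1; move/fdisjointP: dJ => /(_ i iJ1); rewrite iJ2.
have -> : cyl J1 s `&` cyl J2 t = \bigcap_(i in [set` (J1 `|` J2)%fset]) (X i @^-1` A i).
  apply/seteqP; split=> w.
    move=> [w1 w2] i /=; rewrite inE /A => /orP[iJ|iJ].
      by rewrite iJ; exact: w1.
    by rewrite J2N//; exact: w2.
  move=> Hw; split=> i iJ; have := Hw i; rewrite /= inE iJ ?orbT => /(_ isT).
    by rewrite /A iJ.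
  by rewrite /A J2N.
rewrite indX; last by move=> i /=; rewrite inE => /orP[/D1|/D2].
rewrite !cylE !indX//.
have -> : (\prod_(i <- (J1 `|` J2)%fset) P (X i @^-1` A i) =
    \prod_(i <- (J1 : seq I) ++ J2) P (X i @^-1` A i))%E.
  apply: perm_big; apply: uniq_perm; first exact: fset_uniq.
    rewrite cat_uniq !fset_uniq andbT/= ; apply/hasPn => i /=.
    by move/J2N ->.
  by move=> i; rewrite mem_cat !inE.
rewrite big_cat/=; congr (_ * _)%E; apply: eq_big_seq => i iJ; rewrite /A.
  by rewrite iJ.
by rewrite J2N.
Qed.

Let indep_cyl_event J1 J2 s E : [set` J1] `<=` D -> [set` J2] `<=` D ->
  [disjoint J1 & J2]%fset -> depends_on J2 E ->
  P (cyl J1 s `&` event E) = (P (cyl J1 s) * P (event E))%E.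
Proof.
move=> D1 D2 dJ dE; have mE := measurable_event dE.
rewrite (partition J2); last exact: measurableI.
rewrite [P (event E)](partition J2)// ge0_mule_fsumr//.
apply: eq_fsbigr => S _.
have [ES|ES] := pselect (E (ofset S)).
  have -> : event E `&` cyl J2 (ofset S) = cyl J2 (ofset S).
    apply/seteqP; split=> w /=; first by case.
    by move=> wS; split=> //; apply: dE ES => i iJ; rewrite wS.
  rewrite -indep_cyl//; congr (P _); rewrite -setIA; congr (_ `&` _).
  apply/seteqP; split=> w /=; first by case.
  by move=> wS; split=> //; apply: dE ES => i iJ; rewrite wS.
have e0 : event E `&` cyl J2 (ofset S) = set0.
  by apply/seteqP; split=> // w [Ew wS]; apply: ES; apply: dE Ew.
by rewrite -setIA e0 setI0 measure0 mule0.
Qed.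

(** Sum over the configurations on [J1]: on each of them [E1] holds throughout or fails
    throughout. *)
Lemma independent_events J1 J2 E1 E2 : [set` J1] `<=` D -> [set` J2] `<=` D ->
  [disjoint J1 & J2]%fset -> depends_on J1 E1 -> depends_on J2 E2 ->
  P (event E1 `&` event E2) = (P (event E1) * P (event E2))%E.
Proof.
move=> D1 D2 dJ dE1 dE2.
have mE1 := measurable_event dE1; have mE2 := measurable_event dE2.
rewrite (partition J1); last exact: measurableI.
rewrite [P (event E1)](partition J1)// ge0_mule_fsuml//.
apply: eq_fsbigr => S _.
have [ES|ES] := pselect (E1 (ofset S)).
  have E1S : event E1 `&` cyl J1 (ofset S) = cyl J1 (ofset S).
    apply/seteqP; split=> w /=; first by case.
    by move=> wS; split=> //; apply: dE1 ES => i iJ; rewrite wS.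
  by rewrite setIAC E1S (@indep_cyl_event J1 J2).
have e0 : event E1 `&` cyl J1 (ofset S) = set0.
  by apply/seteqP; split=> // w [Ew wS]; apply: ES; apply: dE1 Ew.
by rewrite setIAC e0 set0I measure0 mul0e.
Qed.

(** Conditioning: once the state of [J1] is fixed, the first argument of [E] is a constant and the
    remaining event is independent of [J1]. This serves for random clusters found by looking at [J1]
    only. *)
Lemma conditional_bound J1 J2 (E : pred I -> pred I -> Prop) (c : \bar R) :
  [set` J1] `<=` D -> [set` J2] `<=` D -> [disjoint J1 & J2]%fset ->
  (forall t, depends_on J1 (E^~ t)) -> (forall s, depends_on J2 (E s)) ->
  (forall s, P (event (E s)) <= c)%E ->
  (P [set w | E (positive w) (positive w)] <= c)%E.
Proof.
move=> D1 D2 dJ dE1 dE2 Ec.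
have dE : depends_on (J1 `|` J2)%fset (fun s => E s s).
  move=> s t st Es; apply: (dE2 t s); last apply: (dE1 s s) => //.
    by move=> i iJ; rewrite st// inE iJ orbT.
  by move=> i iJ; rewrite st// inE iJ.
have mE := measurable_event dE.
rewrite -[X in P X]/(event (fun s => E s s)) (partition J1)//.
have c0 : (0 <= c)%E by apply: le_trans (Ec xpred0); exact: measure_ge0.
have h S : (P (event (fun s => E s s) `&` cyl J1 (ofset S)) <=
           P (cyl J1 (ofset S)) * c)%E.
  apply: (@le_trans _ _ (P (cyl J1 (ofset S) `&` event (E (ofset S))))).
    apply: le_measure; rewrite ?inE.
    - exact: measurableI.
    - by apply: measurableI => //; exact: measurable_event (dE2 _).
    - move=> w [Ew wS]; split=> //; exact: dE1 Ew.
  by rewrite (@indep_cyl_event J1 J2)// lee_wpmul2l.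
apply: le_trans (lee_fsum _ (fun S _ => h S)) _; first exact: finite_fset.
rewrite -ge0_mule_fsuml//.
have -> : (\sum_(S \in [set` fpowerset J1]) P (cyl J1 (ofset S)) = 1)%E.
  rewrite -(probability_setT P) (partition J1 measurableT).
  by apply: eq_fsbigr => S _; rewrite setTI.
by rewrite mul1e.
Qed.

End local_events.

(** * Edges between finite sets of vertices *)

Definition edges (G : choiceType) (U V : {fset G}) : {fset {fset G}} :=
  seq_fset tt
    [seq [fset p.1; p.2]%fset | p <- [seq (u, v) | u <- U, v <- V] & p.1 != p.2].

Lemma edgesP (G : choiceType) (U V : {fset G}) e :
  reflect (exists u v, [/\ u \in U, v \in V, u != v & e = [fset u; v]%fset])
    (e \in edges U V).
Proof.
rewrite seq_fsetE; apply: (iffP mapP) => [[[u v]]|[u [v [uU vV uv ->]]]].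
  rewrite mem_filter /= => /andP[uv /allpairsP[[a c] /= [aU cV [ua vc]]]] ->.
  by exists u, v; rewrite uv ua vc.
exists (u, v) => //; rewrite mem_filter /= uv /=.
by apply/allpairsP; exists (u, v).
Qed.

Lemma fset2_inj (G : choiceType) (u v u' v' : G) :
  [fset u; v]%fset = [fset u'; v']%fset ->
  (u = u' /\ v = v') \/ (u = v' /\ v = u').
Proof.
move=> /fsetP E.
have := E u; have := E v; have := E u'; have := E v'; rewrite !inE !eqxx !orbT /=.
rewrite [v' == u]eq_sym [v' == v]eq_sym [u' == u]eq_sym [u' == v]eq_sym.
case: (u =P u') => [->|_] /=.
  case: (v =P v') => [->|vv'] /=; first by left.
  by rewrite !orbF => /eqP h1 _ /esym/eqP h2 _; case: vv'; rewrite h2 h1.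
by case: (v =P u') => [->|//] /=; case: (u =P v') => [->|//]; right.
Qed.

Lemma edges_card2 (G : choiceType) (U V : {fset G}) :
  [set` edges U V] `<=` [set e : {fset G} | #|` e|%fset = 2%N].
Proof. by move=> _ /= /edgesP[u [v [_ _ uv ->]]]; rewrite cardfs2 uv. Qed.

Lemma edges_sub (G : choiceType) (U V U' V' : {fset G}) :
  (U `<=` U')%fset -> (V `<=` V')%fset -> (edges U V `<=` edges U' V')%fset.
Proof.
move=> /fsubsetP UU' /fsubsetP VV'; apply/fsubsetP => e /edgesP[u [v [uU vV uv ->]]].
by apply/edgesP; exists u, v; rewrite UU'// VV'.
Qed.

Lemma edges_disjoint (G : choiceType) (U V U' V' : {fset G}) :
  [disjoint V & U']%fset -> [disjoint V & V']%fset ->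
  [disjoint edges U V & edges U' V']%fset.
Proof.
move=> /fdisjointP VU' /fdisjointP VV'; apply/fdisjointP => _ /edgesP[u [v [uU vV _ ->]]].
apply/negP => /edgesP[u' [v' [uU' vV' _ /fset2_inj[[_ vE]|[_ vE]]]]].
  by have := VV' _ vV; rewrite vE vV'.
by have := VU' _ vV; rewrite vE uU'.
Qed.

Lemma edgesC (G : choiceType) (U V : {fset G}) : edges U V = edges V U.
Proof.
by apply/fsetP => e; apply/edgesP/edgesP => -[u [v [uU vV uv ->]]];
  exists v, u; split=> //; rewrite 1?eq_sym// fsetUC.
Qed.

(** For disjoint sets no edge arises from two pairs, so products over edges become double products
    over vertices. *)
Lemma edges_perm (G : choiceType) (U V : {fset G}) : [disjoint U & V]%fset ->
  perm_eq (edges U V) [seq [fset u; v]%fset | u <- U, v <- V].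
Proof.
move=> /fdisjointP UV; apply: uniq_perm; first exact: fset_uniq.
  apply: allpairs_uniq; [exact: fset_uniq|exact: fset_uniq|].
  move=> [u v] [u' v'] /allpairsP[[a b] /= [aU bV [-> ->]]].
  move=> /allpairsP[[a' b'] /= [aU' bV' [-> ->]]] /= /fset2_inj[[-> ->]//|[abE _]].
  by have := UV _ aU; rewrite abE bV'.
move=> e; apply/edgesP/allpairsP => [[u [v [uU vV uv ->]]]|[[u v] /= [uU vV ->]]].
  by exists (u, v).
exists u, v; split=> //; apply/negP => /eqP uvE.
by have := UV _ uU; rewrite uvE vV.
Qed.

(* A configuration is given by the predicate s of open edges. *)
Definition no_edge (G : choiceType) (U V : {fset G}) (s : pred {fset G}) : Prop :=
  {in edges U V, forall e, ~~ s e}.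

Lemma depends_on_no_edge (G : choiceType) (U V : {fset G}) J :
  (edges U V `<=` J)%fset -> depends_on J (no_edge U V).
Proof. by move=> /fsubsetP UVJ s t st h e eE; rewrite -st ?UVJ// h. Qed.

Lemma poisson_prob0 (R : realType) (r : R) : 0 <= r ->
  poisson_prob r 0 [set 0%N] = (expR (- r))%:E.
Proof.
rewrite le_eqVlt /poisson_prob => /predU1P[<-|r0].
  by rewrite ltxx oppr0 expR0 diracE mem_set.
rewrite r0 esum_set1 ?lee_fin ?poisson_pmf_ge0//.
by rewrite /poisson_pmf r0 expr0 fact0 invr1 !mul1r.
Qed.

(** * Edge probabilities and measurability of percolation *)

Section multigraph.
Context d (T : measurableType d) (R : realType) (P : probability T R).
Context (G : countZmodType) (mu : G -> R) (lam : R) (N : {fset G} -> {RV P >-> nat}).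
Hypotheses (mu_ge0 : forall y, 0 <= mu y) (lam_ge0 : 0 <= lam).
Hypothesis N_poisson : is_poisson_multigraph mu lam N.

Let indN : mutually_independent [set e : {fset G} | #|` e|%fset = 2%N] N.
Proof. by case: N_poisson. Qed.

(** Independence gives a product of Poisson probabilities of the value 0, and the exponents add
    up. *)
Lemma prob_no_edge (U V : {fset G}) : [disjoint U & V]%fset ->
  P (event N (no_edge U V)) =
  (expR (- (lam * \sum_(u <- U) \sum_(v <- V) mu (v - u))))%:E.
Proof.
move=> UV.
have -> : event N (no_edge U V) =
    \bigcap_(e in [set` edges U V]) (N e @^-1` [set 0%N]).
  apply/seteqP; split=> w /= Hw e /= eE; have := Hw e eE.
    by rewrite /positive lt0n negbK => /eqP.
  by rewrite /positive /= lt0n negbK => ->.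
rewrite indN; last exact: edges_card2.
rewrite (perm_big _ (edges_perm UV))/= big_allpairs_dep /= mulr_sumr -sumrN expR_sum.
rewrite -prodEFin; apply: eq_big_seq => u uU.
rewrite mulr_sumr -sumrN expR_sum -prodEFin; apply: eq_big_seq => v vV.
have uv : u != v.
  by apply/negP => /eqP uvE; move/fdisjointP: UV => /(_ _ uU); rewrite uvE vV.
by rewrite -poisson_prob0 ?mulr_ge0// -(edge_law N_poisson uv).
Qed.

Lemma prob_edge_le (U V : {fset G}) : [disjoint U & V]%fset ->
  (P (~` event N (no_edge U V)) <=
   (lam * \sum_(u <- U) \sum_(v <- V) mu (v - u))%:E)%E.
Proof.
move=> UV; rewrite probability_setC; last first.
  exact: measurable_event (depends_on_no_edge (fsubset_refl _)).
rewrite prob_no_edge// -EFinB lee_fin; set x := lam * _.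
by have := expR_ge1Dx (- x); lra.
Qed.

Let measurable_adjacent u v :
  measurable [set w | Defs.adjacent (fun e : {fset G} => N e w) u v].
Proof.
rewrite /Defs.adjacent; case: (u != v) => /=.
  rewrite -[X in measurable X]setTI.
  exact: (@measurable_funPT _ _ _ _ (N [fset u; v]%fset) measurableT [set k | (0 < k)%N]).
rewrite (_ : [set w | _] = set0)//; apply/seteqP; split=> //.
Qed.

Let measurable_path u p :
  measurable [set w | path (Defs.adjacent (fun e : {fset G} => N e w)) u p].
Proof.
elim: p u => [|v p IH] u /=.
  by rewrite (_ : [set w | _] = setT)//; apply/seteqP; split.
rewrite (_ : [set w | _] = [set w | Defs.adjacent (fun e : {fset G} => N e w) u v] `&`
   [set w | path (Defs.adjacent (fun e : {fset G} => N e w)) v p]); first exact: measurableI.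
by apply/seteqP; split=> w /=; [move=> /andP[]|move=> [-> ->]].
Qed.

(** The component of [g] is infinite when, for every finite [V], some path from [g] ends outside
    [V]; as [G] is countable, these are countable operations. *)
Lemma measurable_infinite_component :
  measurable [set w | has_infinite_component (fun e : {fset G} => N e w)].
Proof.
rewrite (_ : [set w | _] = \bigcup_(g : G) \bigcap_(V : {fset G})
    \bigcup_(p : seq G) (if last g p \in V then set0 else
      [set w | path (Defs.adjacent (fun e : {fset G} => N e w)) g p])).
  apply: countable_bigcupT_measurable => // g.
  rewrite -[X in measurable X]setCK setC_bigcap; apply: measurableC.
  apply: countable_bigcupT_measurable => // V; apply: measurableC.
  by apply: countable_bigcupT_measurable => // p; case: ifP.
apply/seteqP; split=> w.
  move=> [g ginf]; exists g => // V _.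
  have [h [[p gp lp] hV]] : exists h, component (fun e : {fset G} => N e w) g h /\ h \notin V.
    apply/not_existsP => nh; apply: ginf.
    apply: (@sub_finite_set _ _ [set` V]); last exact: finite_fset.
    by move=> h hg /=; have /not_andP[//|/negP] := nh h; rewrite negbK.
  by exists p => //; rewrite lp (negPf hV).
move=> [g _ gw]; exists g => /finite_fsetP[V gV].
have [p _] := gw V I; case: ifPn => // lpV gp.
suff : [set` V] (last g p) by rewrite /= (negPf lpV).
by rewrite -gV; exists p.
Qed.

End multigraph.

(** * Balls and shells *)

(** A union bound whose sum is controlled by a telescoping nonnegative sequence, so that no series
    has to be evaluated. *)
Lemma prob_bigcup_telescope d (T : measurableType d) (R : realType)
    (P : probability T R) (E : nat -> set T) (K : nat) (g : nat -> R) :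
  (forall k, measurable (E k)) -> (forall k, 0 <= g k) ->
  (forall k, (K <= k)%N -> (P (E k) <= (g k - g k.+1)%:E)%E) ->
  (P (\bigcup_(k in [set k | (K <= k)%N]) E k) <= (g K)%:E)%E.
Proof.
move=> mE g0 PE.
apply: (@le_trans _ _ (\sum_(K <= k <oo) P (E k))%E).
  apply: measure_sigma_subadditive_tail => //; first exact: bigcup_measurable.
  by move=> w [k /= Kk Ew]; exists k => //=; apply/negP; rewrite -leqNgt.
apply: lime_le; first exact: is_cvg_nneseries.
near=> n.
have Kn : (K <= n)%N by near: n; exists K.
apply: (@le_trans _ _ (\sum_(K <= k < n) (g k - g k.+1)%:E)%E).
  rewrite big_nat_cond [X in (_ <= X)%E]big_nat_cond; apply: lee_sum => k.
  by rewrite andbT => /andP[Kk _]; exact: PE.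
rewrite sumEFin lee_fin (@telescope_sumr_eq _ _ _ (fun k => - g k))//.
  by rewrite opprK gerDr oppr_le0.
by move=> k _; rewrite opprK addrC.
Unshelve. all: by end_near.
Qed.

Lemma prob_bigcup_geometric d (T : measurableType d) (R : realType)
    (P : probability T R) (E : nat -> set T) (K : nat) (c : R) :
  (forall k, measurable (E k)) -> 0 <= c ->
  (forall k, (K <= k)%N -> (P (E k) <= (c / 2 ^+ k)%:E)%E) ->
  (P (\bigcup_(k in [set k | (K <= k)%N]) E k) <= (c * 2 / 2 ^+ K)%:E)%E.
Proof.
move=> mE c0 PE.
apply: (prob_bigcup_telescope (g := fun k => c * 2 / 2 ^+ k)) => // k.
  by rewrite divr_ge0 ?mulr_ge0 ?exprn_ge0.
move=> /PE /le_trans; apply; rewrite lee_fin exprS.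
by rewrite le_eqVlt; apply/orP; left; apply/eqP; field; rewrite expf_neq0.
Qed.

Section lball.
Variable b : nat.

Definition lball (n : nat) : {fset Zb_sum b} :=
  seq_fset tt [seq rVpoly r | r <- enum {: 'rV['Z_b]_n}].

Lemma mem_lball n (y : Zb_sum b) : (y \in lball n) = (ell y <= n)%N.
Proof.
rewrite seq_fsetE; apply/mapP/idP => [[r _ ->]|yn]; first exact: size_poly.
by exists (poly_rV (y : {poly 'Z_b}) : 'rV_n); rewrite ?mem_enum// poly_rV_K.
Qed.

Lemma lball_sub m n : (m <= n)%N -> (lball m `<=` lball n)%fset.
Proof. by move=> mn; apply/fsubsetP => y; rewrite !mem_lball => /leq_trans; apply. Qed.

Definition shell m n : {fset Zb_sum b} := (lball n `\` lball m)%fset.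

Lemma mem_shell m n y : (y \in shell m n) = (m < ell y <= n)%N.
Proof. by rewrite inE !mem_lball ltnNge. Qed.

Lemma lball_shell_disjoint k m n : (k <= m)%N -> [disjoint lball k & shell m n]%fset.
Proof.
move=> km; apply/fdisjointP => y; rewrite mem_lball mem_shell => yk.
by rewrite ltnNge (leq_trans yk km).
Qed.

Hypothesis hb : (2 <= b)%N.

Lemma card_lball n : #|` lball n|%fset = (b ^ n)%N.
Proof.
rewrite size_seq_fset undup_id.
  rewrite size_map -cardE card_mx mul1n card_ord Zp_cast//.
by rewrite map_inj_uniq ?enum_uniq//; exact: can_inj rVpolyK.
Qed.

Lemma card_shell n : #|` shell n n.+1|%fset = (b ^ n.+1 - b ^ n)%N.
Proof. by rewrite cardfsD (fsetIidPr (lball_sub (leqnSn n))) !card_lball. Qed.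

Lemma ell_sub_small (u v : Zb_sum b) : (ell u < ell v)%N -> ell (v - u) = ell v.
Proof. by move=> uv; rewrite /ell size_polyDl// size_polyN. Qed.

(** The [b ^ l - b ^ (l - 1)] points with [ell v = l] have total weight [(1 - 1 / b) * b ^- l], at
    most [b ^- (l - 1) - b ^- l]; these bounds telescope. *)
Lemma shell_weight (R : realType) m n : (m <= n)%N ->
  \sum_(v <- shell m n) (b%:R ^- (2 * ell v) : R) <= b%:R ^- m - b%:R ^- n.
Proof.
have b0 : 0 < b%:R :> R by rewrite ltr0n (leq_trans _ hb).
move=> mn; rewrite -(subnKC mn); elim: (n - m)%N => [|k IH].
  rewrite addn0 subrr (_ : shell m m = fset0); last first.
    by apply/fsetP => y; rewrite mem_shell inE; case: ltnP => //= /ltnW; lia.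
  by rewrite big_seq_fset0.
set n' := (m + k)%N in IH *; rewrite addnS -/n'.
have mn' : (m <= n')%N by exact: leq_addr.
have pe : perm_eq (shell m n'.+1) ((shell m n' : seq _) ++ shell n' n'.+1).
  apply: uniq_perm; first exact: fset_uniq.
    rewrite cat_uniq !fset_uniq andbT /=; apply/hasPn => y /=.
    by rewrite !mem_shell; lia.
  by move=> y; rewrite mem_cat !mem_shell; lia.
rewrite (perm_big _ pe) big_cat/=.
have -> : \sum_(v <- shell n' n'.+1) (b%:R ^- (2 * ell v) : R) =
    (b%:R ^+ n'.+1 - b%:R ^+ n') / b%:R ^+ (2 * n'.+1).
  rewrite (eq_big_seq (fun=> b%:R ^- (2 * n'.+1))); last first.
    by move=> v; rewrite mem_shell => /andP[v1 v2]; congr (_ ^- (2 * _)); lia.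
  rewrite big_const_seq count_predT -/(#|` _|%fset) card_shell iter_addr_0.
  rewrite -[LHS]mulr_natl natrB ?leq_exp2l//.
  by rewrite !natrX.
have : (b%:R ^+ n'.+1 - b%:R ^+ n') / b%:R ^+ (2 * n'.+1) <=
    b%:R ^- n' - b%:R ^- n'.+1 :> R.
  set x := b%:R ^+ n' : R.
  have x0 : 0 < x by rewrite exprn_gt0.
  have -> : b%:R ^+ (2 * n'.+1) = (b%:R * x) ^+ 2 :> R by rewrite mulnC exprM /x -exprS.
  rewrite exprS -/x.
  have -> : (b%:R * x - x) / (b%:R * x) ^+ 2 = (b%:R - 1) / (b%:R ^+ 2 * x).
    by field; rewrite !gt_eqF.
  have -> : x^-1 - (b%:R * x)^-1 = (b%:R - 1) * b%:R / (b%:R ^+ 2 * x).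
    by field; rewrite !gt_eqF.
  have b1 : 1 <= b%:R :> R by rewrite ler1n (leq_trans _ hb).
  rewrite ler_pM2r ?invr_gt0 ?mulr_gt0 ?exprn_gt0//.
  by rewrite ler_peMr// subr_ge0.
by move: IH; lra.
Qed.

(** Since [ell] is ultrametric, [ell (v - u) = ell v], so each of the [b ^ k] points of the ball
    sees the same weight, at most [f n * b ^- m]. *)
Lemma lball_shell_mass (R : realType) (f : R -> R) k m n :
  (forall x, 0 <= x -> 0 <= f x) ->
  (forall x y, 0 <= x -> x <= y -> f x <= f y) ->
  (k <= m)%N -> (m <= n)%N ->
  \sum_(u <- lball k) \sum_(v <- shell m n) level_measure f (v - u) <=
  f n%:R * b%:R ^+ k / b%:R ^+ m.
Proof.
move=> f_ge0 f_incr km mn.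
have b0 : 0 < b%:R :> R by rewrite ltr0n (leq_trans _ hb).
apply: (@le_trans _ _ (\sum_(u <- lball k) f n%:R / b%:R ^+ m)).
  rewrite big_seq_cond [leRHS]big_seq_cond; apply: ler_sum => u.
  rewrite andbT mem_lball => uk.
  apply: (@le_trans _ _ (\sum_(v <- shell m n) f n%:R * b%:R ^- (2 * ell v))).
    rewrite big_seq_cond [leRHS]big_seq_cond; apply: ler_sum => v.
    rewrite andbT mem_shell => /andP[mv vn].
    rewrite /level_measure ell_sub_small; last by lia.
    by rewrite mulrC ler_wpM2r ?invr_ge0 ?exprn_ge0 ?(ltW b0)// f_incr// ler_nat.
  rewrite -mulr_sumr ler_wpM2l ?f_ge0//.
  by apply: le_trans (shell_weight _ mn) _; rewrite gerBl// invr_ge0 exprn_ge0 ?(ltW b0).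
rewrite big_const_seq count_predT -/(#|` _|%fset) card_lball iter_addr_0.
by rewrite -[leLHS]mulr_natl natrX mulrA [b%:R ^+ k * _]mulrC.
Qed.

End lball.

(** * Comparison with the logarithm and the harmonic series *)

Lemma little_o_ln_bound (R : realType) (f : R -> R) (e : R) :
  (forall x y, 0 <= x -> x <= y -> f x <= f y) ->
  is_little_o f (fun x => ln x) -> 0 < e ->
  exists C, forall x, 1 <= x -> f x <= e * ln x + C.
Proof.
move=> f_incr fo e0.
have : \forall x \near +oo, `|f x / ln x| < e.
  by have := @cvgr_norm_lt _ _ _ _ _ _ _ fo e; rewrite normr0; apply.
move=> [M [_ HM]].
(* Beyond [x0] the logarithm is positive and the little-o estimate applies; up to [x0] monotonicity
   bounds [f] by [f x0]. *)
pose x0 := Num.max 2 (M + 1) : R.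
exists `|f x0| => x x1.
have ln0 : 0 <= ln x by rewrite ln_ge0.
have [xx0|x0x] := leP x x0.
  apply: le_trans (ler_wpDl (mulr_ge0 (ltW e0) ln0) (ler_norm _)).
  by apply: f_incr => //; lra.
apply: (@le_trans _ _ (e * ln x)); last by rewrite lerDl.
have Mx : M < x by apply: lt_trans x0x; rewrite /x0 lt_max; apply/orP; right; lra.
have x2 : 2 < x by apply: le_lt_trans x0x; rewrite /x0 le_max lexx.
have lnx : 0 < ln x by apply: ln_gt0; lra.
have := HM x Mx; rewrite normrM normfV [ `|ln x| ]gtr0_norm// ltr_pdivrMr// => h.
by apply: le_trans (ler_norm _) (ltW h).
Qed.

Lemma harmonic_unbounded (R : realType) (K : nat) (M : R) :
  exists m, M < \sum_(K <= k < K + m) k.+1%:R^-1.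
Proof.
have nd : {homo series (@harmonic R) : n m / (n <= m)%N >-> n <= m}.
  move=> n m nm; rewrite /series/= [leRHS](@big_cat_nat _ _ _ n)//=.
  by rewrite lerDl sumr_ge0// => i _; rewrite harmonic_ge0.
have := nondecreasing_dvgn_lt nd (@dvg_harmonic R).
move=> /cvgryPgt /(_ (M + series harmonic K)) [n _ Hn].
exists n; have := Hn (K + n)%N (leq_addl _ _).
rewrite /series/= [X in _ < X -> _](@big_cat_nat _ _ _ K 0 (K + n))//= ?leq_addr//.
by rewrite [X in _ < X]addrC ltrD2r.
Qed.

(** * No infinite component when f = o(ln) *)

Section no_percolation.
Context d (T : measurableType d) (R : realType) (P : probability T R).
Context (b : nat) (f : R -> R) (lam : R).
Context (N : {fset (Zb_sum b)} -> {RV P >-> nat}).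
Hypotheses (hb : (2 <= b)%N) (lam_gt0 : 0 < lam).
Hypothesis f_ge0 : forall x : R, 0 <= x -> 0 <= f x.
Hypothesis f_incr : forall x y : R, 0 <= x -> x <= y -> f x <= f y.
Hypothesis f_o : is_little_o f (fun x => ln x).
Hypothesis N_poisson : is_poisson_multigraph (@level_measure R b f) lam N.

Let mu := @level_measure R b f.

Let mu_ge0 y : 0 <= mu y.
Proof. by rewrite /mu /level_measure mulr_ge0 ?invr_ge0 ?exprn_ge0// f_ge0. Qed.

Let lam_ge0 : 0 <= lam. Proof. exact: ltW. Qed.

Let indN : mutually_independent [set e : {fset (Zb_sum b)} | #|` e|%fset = 2%N] N.
Proof. by case: N_poisson. Qed.

(* The radii grow fast enough for the long bridges to be summable, and slowly
   enough for ln (r k) to stay of the order of ln k. *)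
Let r (k : nat) := (2 * k ^ 2)%N.

Let r_ndecr k l : (k <= l)%N -> (r k <= r l)%N.
Proof. by move=> kl; rewrite /r leq_mul2l leq_exp2r. Qed.

(** An edge leaving the ball of radius [r k] ends in exactly one shell with [l >= k]; the bridge is
    short when [l = k] and long when [l > k]. *)
Let bridge k l : set T := ~` event N (no_edge (lball b (r k)) (shell b (r l) (r l.+1))).

Let measurable_bridge k l : measurable (bridge k l).
Proof.
by apply: measurableC; exact: measurable_event (depends_on_no_edge (fsubset_refl _)).
Qed.

Let growth : exists2 C, 0 <= C & forall l, lam * f (r l.+1)%:R <= ln l.+1%:R + C.
Proof.
(* This choice makes the coefficient of [ln l.+1] equal to 1, since
   [ln (r l.+1) = ln 2 + 2 * ln l.+1]. *)
have e0 : 0 < (2 * lam)^-1 by rewrite invr_gt0 mulr_gt0.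
have [C HC] := little_o_ln_bound f_incr f_o e0.
exists (`|ln 2 / 2 + lam * C|) => // l.
have := HC (r l.+1)%:R; rewrite ler1n => /(_ isT) h.
apply: le_trans (ler_wpM2l lam_ge0 h) _.
have -> : ln (r l.+1)%:R = ln 2 + 2 * ln l.+1%:R :> R.
  rewrite /r natrM lnM ?posrE ?ltr0n// natrX lnXn ?ltr0n//.
  by rewrite mulr_natl.
have -> : lam * ((2 * lam)^-1 * (ln 2 + 2 * ln l.+1%:R) + C) =
   ln l.+1%:R + (ln 2 / 2 + lam * C).
  by field; rewrite gt_eqF.
by rewrite lerD2l ler_norm.
Qed.

Let bridge_mass k l : (k <= l)%N ->
  \sum_(u <- lball b (r k)) \sum_(v <- shell b (r l) (r l.+1)) mu (v - u) <=
  f (r l.+1)%:R / 2 ^+ (r l - r k).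
Proof.
move=> kl; have rkl := r_ndecr kl.
apply: le_trans (lball_shell_mass hb f_ge0 f_incr rkl (r_ndecr (leqnSn l))) _.
have b0 : 0 < b%:R :> R by rewrite ltr0n (leq_trans _ hb).
have -> : f (r l.+1)%:R * b%:R ^+ r k / b%:R ^+ r l =
    f (r l.+1)%:R / b%:R ^+ (r l - r k).
  rewrite -[in X in _ / X = _](subnK rkl) exprD; field.
  by rewrite !expf_neq0 ?gt_eqF.
rewrite ler_wpM2l ?f_ge0// lef_pV2 ?posrE ?exprn_gt0//.
by rewrite lerXn2r ?nnegrE ?ler_nat.
Qed.

(** The difference [r l - r k = 2 * (l - k) * (l + k)] is at least [k + 2 * l], and one factor
    [2 ^+ l] absorbs the logarithmic bound on [lam * f (r l.+1)]. *)
Let prob_long_bridge : exists2 C, 0 <= C & forall k l, (k < l)%N ->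
  (P (bridge k l) <= (C / 2 ^+ k / 2 ^+ l)%:E)%E.
Proof.
have [C C0 HC] := growth; exists (1 + C); first by rewrite addr_ge0.
move=> k l kl.
apply: le_trans (prob_edge_le mu_ge0 lam_ge0 N_poisson _) _.
  by apply: lball_shell_disjoint; apply: r_ndecr; exact: ltnW.
rewrite lee_fin; apply: le_trans (ler_wpM2l lam_ge0 (bridge_mass (ltnW kl))) _.
rewrite mulrA.
have p2 n : 0 < 2 ^+ n :> R by rewrite exprn_gt0.
apply: (@le_trans _ _ ((1 + C) * 2 ^+ l / 2 ^+ (r l - r k))).
  rewrite ler_pM2r ?invr_gt0//; apply: le_trans (HC l) _.
  have l2 : l%:R <= 2 ^+ l :> R.
    by rewrite -natrX ler_nat ltnW// ltn_expl.
  have one2 : 1 <= 2 ^+ l :> R by rewrite exprn_ege1// ler1n.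
  have lnl : ln l.+1%:R <= l%:R :> R.
    have := @le_ln1Dx R l%:R; rewrite -natr1 addrC; apply.
    by rewrite (lt_le_trans _ (ler0n _ _))// ltrN10.
  by have := ler_wpM2l C0 one2; lra.
rewrite -mulrA -[leRHS]mulrA ler_wpM2l ?addr_ge0//.
have [m ->] : exists m, (r l - r k)%N = (k + l + l + m)%N.
  by exists (r l - r k - (k + l + l))%N; rewrite /r; nia.
rewrite !exprD.
have -> : 2 ^+ l / (2 ^+ k * 2 ^+ l * 2 ^+ l * 2 ^+ m) = 2 ^- k / 2 ^+ l / 2 ^+ m :> R.
  by field; rewrite !gt_eqF.
by rewrite ler_piMr ?mulr_ge0 ?invr_ge0 ?(ltW (p2 _))// invf_le1// exprn_ege1// ler1n.
Qed.

(** By [growth] a short bridge is absent with probability at least [c / k.+1], where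
    [c = expR (- C)]; then [1 - x <= expR (- x)]. *)
Let prob_short_bridge : exists2 c, 0 < c & forall k,
  (P (bridge k k) <= (expR (- (c / k.+1%:R)))%:E)%E.
Proof.
have [C C0 HC] := growth; exists (expR (- C)); first exact: expR_gt0.
move=> k; rewrite /bridge probability_setC; last first.
  exact: measurable_event (depends_on_no_edge (fsubset_refl _)).
rewrite (prob_no_edge mu_ge0 lam_ge0 N_poisson); last exact: lball_shell_disjoint.
rewrite -EFinB lee_fin; apply: le_trans (expR_ge1Dx _).
rewrite lerD2l lerN2 -[k.+1%:R]lnK ?posrE ?ltr0n// -expRN -expRD ler_expR.
have := ler_wpM2l lam_ge0 (bridge_mass (leqnn k)); rewrite subnn expr0 divr1.
by have := HC k; lra.
Qed.

(** The earlier bridges depend only on edges inside the ball of radius [r n], while each edge of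
    bridge [n] has an endpoint outside it, so the probabilities multiply. *)
Let prob_all_short c K m :
  (forall k, (P (bridge k k) <= (expR (- (c / k.+1%:R)))%:E)%E) ->
  (P (\bigcap_(k in [set k | (K <= k < K + m)%N]) bridge k k) <=
   (expR (- (c * \sum_(K <= k < K + m) k.+1%:R^-1)))%:E)%E.
Proof.
move=> Hc; elim: m => [|m IH].
  by rewrite addn0 big_geq// mulr0 oppr0 expR0 probability_le1//;
    apply: fin_bigcap_measurable => //;
    apply: (@sub_finite_set _ _ `I_K) => // k /= /andP[]; lia.
pose n := (K + m)%N.
pose E1 s := forall k, (K <= k < n)%N ->
  ~ no_edge (lball b (r k)) (shell b (r k) (r k.+1)) s.
pose E2 s := ~ no_edge (lball b (r n)) (shell b (r n) (r n.+1)) s.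
pose J1 := edges (lball b (r n)) (lball b (r n)).
pose J2 := edges (shell b (r n) (r n.+1)) (lball b (r n)).
have dE1 : depends_on J1 E1.
  move=> s t st Es k kn nk; apply: (Es k kn).
  apply: (@depends_on_no_edge _ _ _ J1) nk; last by move=> e eJ; rewrite st.
  have kn' : (k < n)%N by case/andP: kn.
  apply: edges_sub; first by apply: lball_sub; apply: r_ndecr; lia.
  apply: fsubset_trans (fsubsetDl _ _) _; exact/lball_sub/r_ndecr.
have dE2 : depends_on J2 E2.
  move=> s t st Es nk; apply: Es.
  apply: (@depends_on_no_edge _ _ _ J2) nk; last by move=> e eJ; rewrite st.
  by rewrite /J2 edgesC.
have dJ : [disjoint J1 & J2]%fset.
  rewrite fdisjoint_sym /J2 edgesC; apply: edges_disjoint;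
  by rewrite fdisjoint_sym; exact: lball_shell_disjoint.
have -> : \bigcap_(k in [set k | (K <= k < K + m.+1)%N]) bridge k k =
    event N E1 `&` event N E2.
  apply/seteqP; split=> w.
    move=> Hw; split; first by move=> k kn; apply: (Hw k); rewrite /= addnS; lia.
    by apply: (Hw n); rewrite /= addnS; lia.
  move=> [w1 w2] k /=; rewrite addnS ltnS [(k <= _)%N]leq_eqVlt => /andP[Kk /orP[/eqP kn|kn]].
    by rewrite kn.
  by apply: (w1 k); rewrite Kk.
rewrite (independent_events indN _ _ dJ dE1 dE2); [|exact: edges_card2..].
rewrite addnS big_nat_recr ?leq_addr//= mulrDr opprD expRD EFinM.
by apply: lee_pmul => //; exact: Hc.
Qed.

(** Unless some [k >= K] has a long bridge, all short ones from [K] on occur, which has probability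
    0 as the harmonic series diverges. Long bridges cost at most [C * 2 / 2 ^+ K]. *)
Let prob_bad_tail K :
  P (\bigcap_(k in [set k | (K <= k)%N]) \bigcup_(l in [set l | (k <= l)%N]) bridge k l) = 0%E.
Proof.
have [C C0 HC] := prob_long_bridge.
have [c c0 Hc] := prob_short_bridge.
pose F K := \bigcap_(k in [set k | (K <= k)%N]) \bigcup_(l in [set l | (k <= l)%N]) bridge k l.
have mF K' : measurable (F K').
  by apply: bigcap_measurable => [|k _]; [exists K' => /=|exact: bigcup_measurable].
pose L k := \bigcup_(l in [set l | (k < l)%N]) bridge k l.
have mL k : measurable (L k) by exact: bigcup_measurable.
have PL k : (P (L k) <= (C / 2 ^+ k)%:E)%E.
  apply: (le_trans (@prob_bigcup_geometric _ _ _ P (bridge k) k.+1 (C / 2 ^+ k) _ _ _)) => //.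
  - by rewrite divr_ge0// exprn_ge0.
  - by move=> l; exact: HC.
  - rewrite lee_fin exprS invfM mulrA mulfK//.
    rewrite ler_piMr ?divr_ge0 ?exprn_ge0// invf_le1 ?exprn_gt0//.
    by rewrite exprn_ege1// ler1n.
have PF K' m : (P (F K') <= (expR (- (c * \sum_(K' <= k < K' + m) k.+1%:R^-1)))%:E
    + (C * 2 / 2 ^+ K')%:E)%E.
  pose S := \bigcap_(k in [set k | (K' <= k < K' + m)%N]) bridge k k.
  have mS : measurable S.
    by apply: fin_bigcap_measurable => //;
      apply: (@sub_finite_set _ _ `I_(K' + m)) => // k /= /andP[].
  pose L' := \bigcup_(k in [set k | (K' <= k)%N]) L k.
  have mL' : measurable L' by exact: bigcup_measurable.
  apply: (@le_trans _ _ (P (S `|` L'))).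
    apply: le_measure; rewrite ?inE//; first exact: measurableU.
    move=> w Fw; have [Lw|nL] := pselect (L' w); [by right|left].
    move=> k /= /andP[Kk km]; have [l /= kl wl] := Fw k Kk.
    move: kl; rewrite leq_eqVlt => /orP[/eqP kl|kl]; first by rewrite {2}kl.
    by exfalso; apply: nL; exists k => //; exists l.
  apply: (le_trans (measureU2 _ mS mL')); apply: leeD; first exact: prob_all_short.
  by apply: prob_bigcup_geometric.
have PF2 K' : (P (F K') <= (C * 2 / 2 ^+ K')%:E)%E.
  apply/lee_addgt0Pr => e e0.
  (* This [m] makes the exponent exceed [e^-1], whence [expR (- x) <= e]. *)
  have [m Hm] := harmonic_unbounded K' ((e * c)^-1).
  apply: le_trans (PF K' m) _; rewrite addeC leeD2l// lee_fin.
  set x := _ * _; have x0 : e^-1 < x.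
    rewrite /x mulrC -ltr_pdivrMr//; apply: le_lt_trans _ Hm.
    by rewrite invfM.
  have ei : 0 < e^-1 by rewrite invr_gt0.
  rewrite expRN -[leRHS]invrK lef_pV2 ?posrE ?expR_gt0//.
  by have := expR_ge1Dx x; lra.
apply/eqP; rewrite -measure_le0; apply/lee_addgt0Pr => e e0; rewrite add0e.
have : C * 2 / 2 ^+ n @[n --> \oo] --> C * 2 * 0.
  apply: cvgM; first exact: cvg_cst.
  rewrite (_ : (fun n => _) = (fun n => (1 / 2) ^+ n)); last first.
    by apply/funext => n; rewrite expr_div_n expr1n div1r.
  by apply: cvg_expr; rewrite ger0_norm; lra.
rewrite mulr0 => /cvgr_lt /(_ e e0) [n _ Hn].
(* [F] increases with its index, so the bound may be taken at an arbitrarily late one. *)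
apply: (@le_trans _ _ (P (F (K + n)%N))).
  apply: le_measure; rewrite ?inE//; try exact: mF.
  by move=> w Fw k /= Kk; apply: Fw => /=; lia.
apply: le_trans (PF2 _) _; rewrite lee_fin ltW//; apply: Hn => /=; exact: leq_addl.
Qed.

Lemma prob_infinite_component0 :
  P [set w | has_infinite_component (fun e : {fset (Zb_sum b)} => N e w)] = 0%E.
Proof.
pose F K := \bigcap_(k in [set k | (K <= k)%N]) \bigcup_(l in [set l | (k <= l)%N]) bridge k l.
have mF K' : measurable (F K').
  by apply: bigcap_measurable => [|k _]; [exists K' => /=|exact: bigcup_measurable].
apply/eqP; rewrite -measure_le0.
apply: (@le_trans _ _ (P (\bigcup_K F K))).
  apply: le_measure; rewrite ?inE.
  - exact: measurable_infinite_component.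
  - exact: bigcup_measurable.
  (* For [k >= ell g] the ball of radius [r k] contains [g]; without a bridge out of it the
     component is trapped in a finite set. *)
  move=> w [g ginf]; exists (ell g) => // k /= gk.
  apply: contrapT => nb; apply: ginf.
  apply: (@sub_finite_set _ _ [set` lball b (r k)]); last exact: finite_fset.
  have gr : g \in lball b (r k).
    by rewrite mem_lball (leq_trans gk)// /r; nia.
  move=> h [p]; elim: p g gr {gk} => [|v p IH] g gr /=; first by move=> _ <-.
  move=> /andP[/andP[gv ogv] vp] lp; apply: (IH v) => //.
  apply/negPn/negP => vr; apply: nb.
  have rv : (r k < ell v)%N by rewrite ltnNge -mem_lball.
  (* The least such [l] names the shell containing [v]; for [l = 0] one uses [r 0 = 0]. *)
  have ex : exists l, (ell v <= r l.+1)%N by exists (ell v); rewrite /r; nia.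
  case: (ex_minnP ex) => l vl lmin.
  have lv : (r l < ell v)%N.
    case: l vl lmin => [|l] vl lmin; first by rewrite /r; lia.
    by rewrite ltnNge; apply/negP => /lmin; rewrite ltnn.
  have kl : (k <= l)%N.
    rewrite leqNgt; apply/negP => lk.
    by have := r_ndecr lk; lia.
  exists l => // ne; have := ne [fset g; v]%fset.
  rewrite /positive ogv => /(_ _)/negP; apply => //.
  by apply/edgesP; exists g, v; split=> //; rewrite mem_shell lv vl.
apply: (@le_trans _ _ (\sum_(0 <= K <oo) P (F K))%E).
  by apply: measure_sigma_subadditive => //; exact: bigcup_measurable.
by rewrite eseries0// => K _ _; exact: prob_bad_tail.
Qed.

End no_percolation.

(** * Hierarchical clusters *)

Lemma union_bound d (T : measurableType d) (R : realType) (P : probability T R)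
    (I : eqType) (s : seq I) (E : I -> set T) (A : set T) (c : R) :
  measurable A -> (forall i, measurable (E i)) ->
  (forall w, A w -> exists2 i, i \in s & E i w) ->
  {in s, forall i, (P (E i) <= c%:E)%E} ->
  (P A <= ((size s)%:R * c)%:E)%E.
Proof.
move=> mA mE; elim: s A mA => [|i s IH] A mA AE Ec.
  rewrite mul0r (_ : A = set0) ?measure0//; apply/seteqP; split=> // w /AE[].
  by [].
apply: (@le_trans _ _ (P (E i `|` (A `\` E i)))).
  apply: le_measure; rewrite ?inE//; first by apply: measurableU => //; exact: measurableD.
  by move=> w Aw; have [|] := pselect (E i w); [left|right].
apply: (le_trans (measureU2 _ (mE i) (measurableD mA (mE i)))).
rewrite /= -natr1 mulrDl mul1r EFinD addeC; apply: leeD; first by apply: Ec; rewrite mem_head.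
apply: IH; first exact: measurableD.
  move=> w [/AE[j]]; rewrite inE => /predU1P[->//|js Ej _].
  by exists j.
by move=> j js; apply: Ec; rewrite inE js orbT.
Qed.

Lemma card_bigfcup_disjoint (I : eqType) (K : choiceType) (s : seq I)
    (F B : I -> {fset K}) (M : nat) : uniq s ->
  {in s &, forall i j, i != j -> [disjoint B i & B j]%fset} ->
  {in s, forall i, (F i `<=` B i)%fset /\ (M <= #|` F i|)%N} ->
  (size s * M <= #|` (\bigcup_(i <- s) F i)%fset|)%N.
Proof.
elim: s => [|i s IH] //= /andP[iNs us] dB FB.
rewrite big_cons cardfsU.
have -> : (F i `&` (\bigcup_(j <- s) F j) = fset0)%fset.
  apply/fsetP => x; rewrite !inE; apply/negP => /andP[xi /bigfcupP[j]].
  rewrite andbT => js xj.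
  have ij : i != j by apply/negP => /eqP E; rewrite E js in iNs.
  have [Fi _] := FB i (mem_head _ _).
  have [Fj _] := FB j (mem_behead (s := i :: s) js).
  have := fdisjointP (dB i j (mem_head _ _) (mem_behead (s := i :: s) js) ij) x.
  by rewrite (fsubsetP Fi)// (fsubsetP Fj)// => /(_ isT).
rewrite cardfs0 subn0 mulSn leq_add//.
  by have [] := FB i (mem_head _ _).
apply: IH => // [j l js ls|j js]; last by apply: FB; rewrite inE js orbT.
by apply: dB; rewrite inE (js, ls) orbT.
Qed.

(** From the cubic term of the exponential series. For [t] of order [width j ^+ 2] it gives
    [width j ^- 6], so the [width j ^+ 2] pairs leave [width j ^- 4]. *)
Lemma expR_inv_cube (R : realType) (t : R) : 0 < t -> expR (- t) <= 6 / t ^+ 3.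
Proof.
move=> t0; rewrite expRN -[leRHS]invrK.
rewrite lef_pV2 ?posrE ?expR_gt0 ?invr_gt0 ?divr_gt0 ?exprn_gt0//.
rewrite invf_div; apply: le_trans (expR_ge1Dxn 2 (ltW t0)).
by rewrite lerDr.
Qed.

Section blocks.
Variables (b n0 : nat).
Hypothesis hb : (2 <= b)%N.
Let G := Zb_sum b.

(* b ^ gap j >= (j + 2)^2, so that the product of the 1 - b ^- gap j is
   positive: discarding one sub-block at each step leaves a positive density. *)
Definition gap (j : nat) : nat := (2 * up_log b j.+2)%N.

(** Scale 0 starts at radius [n0], so that all levels lie where [f_large] applies. *)
Definition level (j : nat) : nat := (n0 + \sum_(i < j) gap i)%N.

Lemma levelS j : level j.+1 = (level j + gap j)%N.
Proof. by rewrite /level big_ord_recr /= addnA. Qed.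

Definition block (j : nat) (x : G) : {fset G} :=
  seq_fset tt [seq x + z : G | z <- lball b (level j)].

Lemma mem_block j x z : (z \in block j x) = (ell (z - x)%R <= level j)%N.
Proof.
rewrite seq_fsetE; apply/mapP/idP => [[y + ->]|zx]; first by rewrite mem_lball addrC addKr.
by exists (z - x); rewrite ?mem_lball// addrC subrK.
Qed.

(** Representatives of the cosets of the ball of radius [level j] that make up the block of scale
    [j.+1] around [x]. *)
Definition subblocks (j : nat) (x : G) : seq G :=
  [seq (x : {poly 'Z_b}) + 'X^(level j) * rVpoly r | r <- enum {: 'rV['Z_b]_(gap j)}].

Lemma subblocks_diff j x y y' : y \in subblocks j x -> y' \in subblocks j x ->
  y != y' -> (level j < ell (y' - y)%R <= level j.+1)%N.
Proof.
move=> /mapP[r _ ->] /mapP[r' _ ->] rr'.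
rewrite (_ : _ - _ = 'X^(level j) * rVpoly (r' - r) :> {poly _}); last first.
  by rewrite linearB/= mulrBr opprD addrACA subrr add0r.
have r0 : rVpoly (r' - r) != 0.
  apply: contraNneq rr' => /eqP; rewrite linearB/= subr_eq0 => /eqP /(can_inj rVpolyK) ->.
  by [].
rewrite /ell levelS; apply/andP; split; last first.
  apply: leq_trans (size_polyMleq _ _) _; rewrite size_polyXn addSn /=.
  by rewrite leq_add2l size_poly.
(* The leading coefficient of the nonzero factor survives, shifted by [level j]. *)
have := lead_coef_eq0 (rVpoly (r' - r)); rewrite (negPf r0) /lead_coef => /negbT l0.
rewrite ltnNge; apply: contra l0 => sz.
have := nth_default 0 (leq_trans sz (leq_addr (size (rVpoly (r' - r))).-1 _)).
by rewrite coefXnM ltnNge leq_addr/= addKn => ->.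
Qed.

Lemma subblocks_refl j x : x \in subblocks j x.
Proof.
by apply/mapP; exists 0; rewrite ?mem_enum// linear0 mulr0 addr0.
Qed.

Lemma uniq_subblocks j x : uniq (subblocks j x).
Proof.
rewrite map_inj_in_uniq ?enum_uniq// => r r' _ _ /addrI E.
apply: (can_inj rVpolyK); apply/polyP => i.
have := congr1 (fun p : {poly 'Z_b} => p`_(level j + i)) E.
by rewrite !coefXnM ltnNge leq_addr/= addKn.
Qed.

Lemma size_subblocks j x : size (subblocks j x) = (b ^ gap j)%N.
Proof. by rewrite size_map -cardE card_mx mul1n card_ord Zp_cast. Qed.

Lemma ell_add (x y : G) : (ell (x + y)%R <= maxn (ell x) (ell y))%N.
Proof. exact: size_polyD. Qed.

Lemma ell_opp (x : G) : ell (- x) = ell x.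
Proof. exact: size_polyN. Qed.

Lemma block_sub j x y : y \in subblocks j x -> (block j y `<=` block j.+1 x)%fset.
Proof.
move=> yx; apply/fsubsetP => z; rewrite !mem_block => zy.
have yx' : (ell (y - x)%R <= level j.+1)%N.
  have [->|xy] := eqVneq x y; first by rewrite subrr ell0.
  by have /andP[] := subblocks_diff (subblocks_refl j x) yx xy.
rewrite -(subrK y z) -addrA; apply: leq_trans (ell_add _ _) _.
by rewrite geq_max yx' andbT (leq_trans zy)// levelS leq_addr.
Qed.

(** The representatives are more than [level j] apart, and moving inside the two blocks changes the
    difference by at most [level j], which does not affect the ultrametric [ell]. *)
Lemma block_diff j x y y' u v : y \in subblocks j x -> y' \in subblocks j x ->
  y != y' -> u \in block j y -> v \in block j y' ->
  (level j < ell (v - u)%R <= level j.+1)%N.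
Proof.
move=> yx y'x yy'; rewrite !mem_block => uy vy'.
have /andP[h1 h2] := subblocks_diff yx y'x yy'.
have E : (ell ((v - y') - (u - y))%R <= level j)%N.
  by apply: leq_trans (ell_add _ _) _; rewrite ell_opp geq_max vy' uy.
have -> : v - u = (y' - y) + ((v - y') - (u - y)) :> G.
  by rewrite !opprB addrACA [_ + (v - y')]addrC; ring.
suff -> : ell ((y' - y) + ((v - y') - (u - y)) : G) = ell (y' - y)%R by rewrite h1.
by rewrite /ell size_polyDl//; exact: leq_ltn_trans E h1.
Qed.

Lemma block_disjoint j x y y' : y \in subblocks j x -> y' \in subblocks j x ->
  y != y' -> [disjoint block j y & block j y']%fset.
Proof.
move=> yx y'x yy'; apply/fdisjointP => z zy; apply/negP => zy'.
by have := block_diff yx y'x yy' zy zy'; rewrite subrr ell0.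
Qed.

Definition linked (s : pred {fset G}) (U V : {fset G}) : bool :=
  has s (edges U V).

Lemma linkedPn s U V : reflect (no_edge U V s) (~~ linked s U V).
Proof. by apply: (iffP hasPn). Qed.

(* One bad sub-block is tolerated, so that the probability p of being bad
   contributes quadratically, as N^2 p^2, to that of the next scale. *)
Fixpoint good_cluster (s : pred {fset G}) (j : nat) (x : G) : bool * {fset G} :=
  if j is i.+1 then
    let ys := [seq y <- subblocks i x | (good_cluster s i y).1] in
    ((size (subblocks i x) <= (size ys).+1)%N &&
       allrel (fun y y' => (y == y') ||
         linked s (good_cluster s i y).2 (good_cluster s i y').2) ys ys,
     \bigcup_(y <- ys) (good_cluster s i y).2)%fset
  else (true, [fset x]%fset).

Definition good s j x := (good_cluster s j x).1.
Definition cluster s j x := (good_cluster s j x).2.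

Definition good_subblocks s j x := [seq y <- subblocks j x | good s j y].

Lemma goodSE s j x : good s j.+1 x =
  (size (subblocks j x) <= (size (good_subblocks s j x)).+1)%N &&
  allrel (fun y y' => (y == y') || linked s (cluster s j y) (cluster s j y'))
    (good_subblocks s j x) (good_subblocks s j x).
Proof. by []. Qed.

Lemma clusterSE s j x : cluster s j.+1 x =
  (\bigcup_(y <- good_subblocks s j x) cluster s j y)%fset.
Proof. by []. Qed.

Lemma cluster_block s j x : (cluster s j x `<=` block j x)%fset.
Proof.
elim: j x => [|j IH] x.
  by apply/fsubsetP => y; rewrite inE mem_block => /eqP ->; rewrite subrr ell0.
rewrite clusterSE; apply/bigfcupsP => y; rewrite mem_filter => /andP[_ yx] _.
exact: fsubset_trans (IH y) (block_sub yx).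
Qed.

(** The recursion consults only edges inside the block; this makes disjoint blocks independent. *)
Lemma good_cluster_local s t j x :
  {in edges (block j x) (block j x), s =1 t} ->
  good_cluster s j x = good_cluster t j x.
Proof.
elim: j x => [|j IH] x st //.
have E y : y \in subblocks j x -> good_cluster s j y = good_cluster t j y.
  move=> yx; apply: IH => e eE; apply: st.
  by apply: (fsubsetP (edges_sub _ _)) eE; exact: block_sub.
have Eys : good_subblocks s j x = good_subblocks t j x.
  by apply: eq_in_filter => y /E; rewrite /good => ->.
have Ec y : y \in subblocks j x -> cluster s j y = cluster t j y.
  by rewrite /cluster => /E ->.
have sub y : y \in good_subblocks t j x -> y \in subblocks j x.
  by rewrite mem_filter => /andP[].
rewrite [LHS]surjective_pairing [RHS]surjective_pairing; congr pair.
  rewrite -!/(good _ _ _) !goodSE Eys; congr (_ && _).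
  apply: eq_in_all => y /sub yx; apply: eq_in_all => y' /sub y'x.
  rewrite !Ec//; congr (_ || _); apply: eq_in_has => e eE; apply: st.
  by apply: (fsubsetP (edges_sub _ _)) eE;
    apply: fsubset_trans (cluster_block _ _ _) _; exact: block_sub.
rewrite -!/(cluster _ _ _) !clusterSE Eys.
by apply: eq_big_seq => y /sub yx; exact: Ec.
Qed.

(** A guaranteed lower bound rather than the actual size: all but at most one of the [b ^ gap i]
    disjoint sub-clusters contribute. *)
Fixpoint cluster_size (j : nat) : nat :=
  if j is i.+1 then ((b ^ gap i).-1 * cluster_size i)%N else 1%N.

Lemma card_cluster s j x : good s j x -> (cluster_size j <= #|` cluster s j x|)%N.
Proof.
elim: j x => [|j IH] x; first by rewrite cardfs1.
rewrite goodSE clusterSE => /andP[sz _] /=.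
have sub y : y \in good_subblocks s j x -> y \in subblocks j x.
  by rewrite mem_filter => /andP[].
apply: leq_trans (card_bigfcup_disjoint (B := block j) (M := cluster_size j) _ _ _).
- rewrite size_subblocks in sz.
  by rewrite leq_mul2r; apply/orP; right; rewrite -subn1 leq_subLR add1n.
- by rewrite filter_uniq// uniq_subblocks.
- by move=> y y' /sub yx /sub y'x; exact: block_disjoint yx y'x.
- by move=> y; rewrite mem_filter => /andP[gy yx]; split; [exact: cluster_block|exact: IH].
Qed.

Lemma component_trans (K : choiceType) (n : {fset K} -> nat) x y z :
  component n x y -> component n y z -> component n x z.
Proof.
move=> [p xp <-] [q yq <-]; exists (p ++ q); last by rewrite last_cat.
by rewrite cat_path xp.
Qed.

(** Walk to the linking edge inside the first sub-cluster, cross it, and walk on inside the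
    second. *)
Lemma cluster_connected (n : {fset G} -> nat) j x u v :
  let s : pred {fset G} := fun e => (0 < n e)%N in
  good s j x -> u \in cluster s j x -> v \in cluster s j x -> component n u v.
Proof.
move=> s; elim: j x u v => [|j IH] x u v.
  by move=> _; rewrite !inE => /eqP -> /eqP ->; exists [::].
rewrite goodSE clusterSE => /andP[_ /allrelP lk].
move=> /bigfcupP[y + uy] /bigfcupP[y' + vy']; rewrite !andbT => yg y'g.
have gy : good s j y by move: yg; rewrite mem_filter => /andP[].
have gy' : good s j y' by move: y'g; rewrite mem_filter => /andP[].
have /orP[/eqP yy'|] := lk _ _ yg y'g; first by apply: (IH y) => //; rewrite yy'.
move=> /hasP[e /edgesP[u' [v' [u'y v'y uv' ->]]] suv].
apply: component_trans (IH y u u' gy uy u'y) _.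
apply: component_trans (IH y' v' v gy' v'y vy').
by exists [:: v'] => //=; rewrite andbT /Defs.adjacent uv'.
Qed.

Lemma good_nested s j x : (forall i, good s i x) -> x \in cluster s j x.
Proof.
move=> gx; elim: j => [|j IH]; first by rewrite inE.
by rewrite clusterSE; apply/bigfcupP; exists x => //; rewrite mem_filter gx subblocks_refl.
Qed.

End blocks.

(** * An infinite component for large intensities *)

Section percolation.
Context d (T : measurableType d) (R : realType) (P : probability T R).
Context (b n0 : nat) (f : R -> R) (lam : R).
Context (N : {fset (Zb_sum b)} -> {RV P >-> nat}).
Hypotheses (hb : (2 <= b)%N).
Hypothesis f_ge0 : forall x : R, 0 <= x -> 0 <= f x.
Hypothesis f_incr : forall x y : R, 0 <= x -> x <= y -> f x <= f y.
Hypothesis f_large : forall l : nat, (n0 <= l)%N -> (b * l.+2)%:R ^+ 8 <= f l%:R.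
Hypothesis lam_large : 96 * b%:R ^+ 16 * b%:R ^+ (2 * n0) <= lam.
Hypothesis N_poisson : is_poisson_multigraph (@level_measure R b f) lam N.

Let mu := @level_measure R b f.

Let b_gt0 : 0 < b%:R :> R. Proof. by rewrite ltr0n (leq_trans _ hb). Qed.

Let mu_ge0 y : 0 <= mu y.
Proof. by rewrite /mu /level_measure mulr_ge0 ?invr_ge0 ?exprn_ge0// f_ge0. Qed.

Let lam_gt0 : 0 < lam.
Proof. by apply: lt_le_trans lam_large; rewrite !mulr_gt0 ?exprn_gt0. Qed.

Let indN : mutually_independent [set e : {fset (Zb_sum b)} | #|` e|%fset = 2%N] N.
Proof. by case: N_poisson. Qed.

Let width (j : nat) : R := (b ^ gap b j)%:R.

Let widthE j : width j = (b%:R ^+ up_log b j.+2) ^+ 2.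
Proof. by rewrite /width /gap natrX mulnC exprM. Qed.

Let width_gt0 j : 0 < width j.
Proof. by rewrite widthE !exprn_gt0. Qed.

Let width_ge j : j.+2%:R ^+ 2 <= width j.
Proof.
rewrite widthE lerXn2r ?nnegrE ?exprn_ge0 ?ler0n ?(ltW b_gt0)//.
by rewrite -natrX ler_nat up_logP.
Qed.

Let width_ge1 j : 1 <= width j.
Proof. by apply: le_trans (width_ge j); rewrite exprn_ege1// ler1n. Qed.

(** [up_log b j.+3] exceeds [up_log b j.+2] by at most 1, and [gap] doubles it. *)
Let widthS j : width j.+1 <= b%:R ^+ 2 * width j.
Proof.
rewrite !widthE -exprMn -exprS lerXn2r ?nnegrE ?exprn_ge0 ?(ltW b_gt0)//.
rewrite -!natrX ler_nat leq_exp2l//.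
apply: up_log_min => //; apply: (@leq_trans (b * j.+2)).
  by apply: (@leq_trans (2 * j.+2)); [lia|rewrite leq_mul2r hb orbT].
by rewrite expnS leq_mul2l up_logP ?orbT.
Qed.

(** If [up_log b j.+2 = e.+1] then [b ^ e < j.+2], hence [width j <= (b * j.+2) ^+ 2]. This explains
    the exponent 8 in [f_large]. *)
Let width_le j : width j ^+ 4 <= (b * j.+2)%:R ^+ 8.
Proof.
rewrite widthE -exprM -[8%N]/(2 * 4)%N lerXn2r ?nnegrE ?exprn_ge0 ?ler0n ?(ltW b_gt0)//.
rewrite -natrX ler_nat; case E : (up_log b j.+2) => [|e].
  by rewrite expn0 muln_gt0 (leq_trans _ hb).
rewrite expnS leq_mul2l; apply/orP; right.
rewrite ltnW// ltnNge; apply/negP => /(up_log_min hb); rewrite E; lia.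
Qed.

Let level_ge j : (n0 + j <= level b n0 j)%N.
Proof.
elim: j => [|j IH]; first by rewrite /level big_ord0.
rewrite levelS; apply: (@leq_trans (n0 + j + 1)); first by rewrite -addnA addn1.
apply: leq_add => //; rewrite /gap muln_gt0 /= lt0n; apply/eqP => E.
by have := @up_logP b j.+2 hb; rewrite E.
Qed.

Let f_level j : width j ^+ 4 <= f (level b n0 j)%:R.
Proof.
apply: le_trans (width_le j) _; apply: le_trans (f_large (leq_trans (leq_addr _ _) (level_ge j))).
rewrite lerXn2r ?nnegrE ?ler0n// ler_nat leq_mul2l; apply/orP; right.
by have := level_ge j; lia.
Qed.

Let cluster_size_ge j :
  b%:R ^+ (level b n0 j) / b%:R ^+ n0 / 2 <= (cluster_size b j)%:R :> R.
Proof.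
(* The extra factor is the product of [1 - 1 / (i + 2) ^ 2] over [i < j] in closed form; it stays
   above 1/2. *)
suff H : b%:R ^+ (level b n0 j) / b%:R ^+ n0 * (j.+2%:R / (2 * j.+1%:R)) <=
    (cluster_size b j)%:R :> R.
  apply: le_trans H; rewrite ler_wpM2l ?divr_ge0 ?exprn_ge0 ?(ltW b_gt0)//.
  by rewrite ler_pdivlMr ?mulr_gt0// mulKf// ler_nat.
elim: j => [|j IH].
  by rewrite /level big_ord0 addn0 divff ?expf_neq0 ?gt_eqF// mul1r mulr1 divff.
rewrite levelS exprD -[b%:R ^+ gap b j]natrX /= natrM -subn1.
rewrite natrB ?expn_gt0 ?(leq_trans _ hb)//.
rewrite -/(width j).
have wj := width_ge j; have w1 := width_ge1 j.
apply: le_trans (ler_wpM2l _ IH); last by rewrite subr_ge0.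
set B := b%:R ^+ level b n0 j / _.
have B0 : 0 <= B by rewrite divr_ge0 ?exprn_ge0 ?(ltW b_gt0).
have -> : b%:R ^+ level b n0 j * width j / b%:R ^+ n0 * (j.+3%:R / (2 * j.+2%:R)) =
    B * (width j * (j.+3%:R / (2 * j.+2%:R))) by rewrite /B; ring.
rewrite [leRHS]mulrCA ler_wpM2l//.
have j1 : 0 < j.+1%:R :> R by [].
have j2 : j.+2%:R = j.+1%:R + 1 :> R by rewrite [RHS]natr1.
have j3 : j.+3%:R = j.+1%:R + 2 :> R by rewrite -natrD addnC.
rewrite j2 j3 in wj *; move: (j.+1%:R) j1 wj => x x0 wx.
rewrite mulrA ler_pdivrMr ?mulr_gt0 ?addr_gt0// -mulrA mulrAC.
have -> : (width j - 1) * ((x + 1) * (2 * (x + 1)) / (2 * x)) =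
   (width j - 1) * (x + 1) ^+ 2 / x by field; rewrite gt_eqF.
by rewrite ler_pdivlMr//; nra.
Qed.

(** The 4 comes from squaring the density 1/2, the power of [b] from squaring the initial density of
    one point per ball of radius [n0]. *)
Let kappa : R := (4 * b%:R ^+ (2 * n0))^-1.

Let kappa_gt0 : 0 < kappa.
Proof. by rewrite invr_gt0 mulr_gt0 ?exprn_gt0. Qed.

(** The right side bounds from below the mass between two clusters. The squared size, of order
    [x ^+ 2], cancels against the weight [(x * w) ^- 2], and [f >= w ^+ 4] leaves [w ^+ 2]. *)
Let link_rate_ge j :
  kappa * width j ^+ 2 <=
  (cluster_size b j)%:R ^+ 2 * (b%:R ^- (2 * level b n0 j.+1) * f (level b n0 j)%:R).
Proof.
pose x : R := b%:R ^+ level b n0 j; pose y : R := b%:R ^+ n0; set w := width j.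
have x0 : 0 < x by rewrite exprn_gt0.
have y0 : 0 < y by rewrite exprn_gt0.
have w0 : 0 < w := width_gt0 j.
have -> : kappa * w ^+ 2 = (x / y / 2) ^+ 2 * ((x * w) ^- 2 * w ^+ 4).
  rewrite /kappa [(2 * n0)%N]mulnC exprM -/y; field.
  by rewrite !gt_eqF.
have -> : b%:R ^- (2 * level b n0 j.+1) = (x * w) ^- 2.
  by rewrite levelS mulnC exprM exprD /w /width natrX.
apply: ler_pM.
- by rewrite exprn_ge0 ?divr_ge0 ?(ltW x0) ?(ltW y0).
- by rewrite mulr_ge0 ?invr_ge0 ?exprn_ge0 ?mulr_ge0 ?(ltW x0) ?(ltW w0).
- by rewrite lerXn2r ?nnegrE ?ler0n ?divr_ge0 ?(ltW x0) ?(ltW y0)//; exact: cluster_size_ge.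
- by rewrite ler_wpM2l ?invr_ge0 ?exprn_ge0 ?mulr_ge0 ?(ltW x0) ?(ltW w0)// f_level.
Qed.

(** Bounds the probability of being bad. The factor [b%:R ^- 8] compensates for [width j.+1 ^+ 4 <=
    b%:R ^+ 8 * width j ^+ 4] in the recursion. *)
Let fail (j : nat) : R := b%:R ^- 8 / 2 / width j ^+ 4.

Let fail_rec j :
  width j * width j * (fail j ^+ 2 + expR (- (lam * (kappa * width j ^+ 2)))) <=
  fail j.+1.
Proof.
set w := width j; have w0 : 0 < w := width_gt0 j.
have w1 : 1 <= w := width_ge1 j.
set B : R := b%:R ^+ 8; have B0 : 0 < B by rewrite exprn_gt0.
set t := lam * kappa.
(* Here 96 = 4 * 24 in [lam_large]: the 4 is that of [kappa], and 24 makes [6 / t ^+ 3] at most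
   [B ^- 2 / 4]. *)
have t1 : 24 * B ^+ 2 <= t.
  rewrite /t /kappa ler_pdivlMr ?mulr_gt0 ?exprn_gt0//.
  by apply: le_trans lam_large; rewrite /B -exprM; lra.
have B1 : 1 <= B by rewrite exprn_ege1// ler1n (leq_trans _ hb).
have B2 : 1 <= B ^+ 2 by rewrite exprn_ege1.
have t0 : 0 < t by nra.
have e6 : expR (- (lam * (kappa * w ^+ 2))) <= (B ^- 2 / 4) / w ^+ 6.
  rewrite mulrA -/t; apply: le_trans (expR_inv_cube (mulr_gt0 t0 (exprn_gt0 _ w0))) _.
  rewrite exprMn -exprM -[(2 * 3)%N]/6%N invfM mulrA ler_wpM2r ?invr_ge0 ?exprn_ge0 ?(ltW w0)//.
  rewrite -invfM -[leLHS]invrK lef_pV2 ?posrE ?invr_gt0 ?divr_gt0 ?mulr_gt0 ?exprn_gt0//.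
  rewrite invf_div ler_pdivlMr//.
  apply: (@le_trans _ _ t); first by lra.
  by rewrite exprSr ler_peMl ?(ltW t0)// exprn_ege1//; lra.
apply: (@le_trans _ _ (w * w * ((B^-1 / 2 / w ^+ 4) ^+ 2 + (B ^- 2 / 4) / w ^+ 6))).
  by rewrite ler_wpM2l ?mulr_ge0 ?(ltW w0)// lerD2l.
have -> : w * w * ((B^-1 / 2 / w ^+ 4) ^+ 2 + (B ^- 2 / 4) / w ^+ 6) =
  B ^- 2 / 4 * (w ^- 6 + w ^- 4) by field; rewrite !gt_eqF.
apply: (@le_trans _ _ (B ^- 2 / 2 / w ^+ 4)).
  have w64 : w ^- 6 <= w ^- 4.
    by rewrite lef_pV2 ?posrE ?exprn_gt0// ler_weXn2l.
  have -> : B ^- 2 / 2 / w ^+ 4 = B ^- 2 / 4 * (w ^- 4 + w ^- 4) by field; rewrite !gt_eqF.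
  by rewrite ler_wpM2l ?lerD2r// divr_ge0 ?invr_ge0 ?exprn_ge0 ?(ltW B0).
rewrite /fail -/B.
have -> : B ^- 2 / 2 / w ^+ 4 = B^-1 / 2 / (B * w ^+ 4) by field; rewrite !gt_eqF.
rewrite ler_wpM2l ?divr_ge0 ?invr_ge0 ?(ltW B0)//.
rewrite lef_pV2 ?posrE ?mulr_gt0 ?exprn_gt0//.
have -> : B * w ^+ 4 = (b%:R ^+ 2 * w) ^+ 4 by rewrite exprMn -exprM.
by rewrite lerXn2r ?nnegrE ?mulr_ge0 ?exprn_ge0 ?(ltW b_gt0) ?(ltW (width_gt0 _)).
Qed.

Let G := Zb_sum b.

Let inner j x : {fset {fset G}} := edges (block n0 j x) (block n0 j x).

Let bad j x : set T := event N (fun s => ~~ good n0 s j x).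

Let bad_local j x : depends_on (inner j x) (fun s => ~~ good n0 s j x).
Proof. by move=> s t st; rewrite /good (good_cluster_local st). Qed.

Let measurable_bad j x : measurable (bad j x).
Proof. exact: measurable_event (@bad_local j x). Qed.

Let unlinked j y y' : set T := event N (fun s =>
  [/\ good n0 s j y, good n0 s j y' & no_edge (cluster n0 s j y) (cluster n0 s j y') s]).

(** Both clusters are determined by the edges inside their blocks; the edges between the blocks are
    independent of these, so the clusters can be treated as fixed. *)
Let prob_unlinked j x y y' : y \in subblocks n0 j x -> y' \in subblocks n0 j x ->
  y != y' -> measurable (unlinked j y y') /\
  (P (unlinked j y y') <= (expR (- (lam * (kappa * width j ^+ 2))))%:E)%E.
Proof.
move=> yx y'x yy'.
pose E s t := [/\ good n0 s j y, good n0 s j y' &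
  no_edge (cluster n0 s j y) (cluster n0 s j y') t].
pose J1 := (inner j y `|` inner j y')%fset.
pose J2 := edges (block n0 j y) (block n0 j y').
have dB := block_disjoint yx y'x yy'.
have dE1 t : depends_on J1 (E^~ t).
  move=> s s' ss'; have ssy : {in inner j y, s =1 s'} by move=> e eJ; rewrite ss'// inE eJ.
  have ssy' : {in inner j y', s =1 s'} by move=> e eJ; rewrite ss'// inE eJ orbT.
  by rewrite /E /good /cluster (good_cluster_local ssy) (good_cluster_local ssy').
have dE2 s : depends_on J2 (E s).
  move=> t t' tt' [gy gy' ne]; split=> //.
  apply: depends_on_no_edge tt' ne.
  by apply: edges_sub; exact: cluster_block.
have J1D : [set` J1] `<=` [set e : {fset G} | #|` e|%fset = 2%N].
  by move=> e /=; rewrite inE => /orP[]; exact: edges_card2.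
have J2D : [set` J2] `<=` [set e : {fset G} | #|` e|%fset = 2%N] by exact: edges_card2.
have dJ : [disjoint J1 & J2]%fset.
  have dB' : [disjoint block n0 j y' & block n0 j y]%fset by rewrite fdisjoint_sym.
  have d1 : [disjoint J2 & inner j y]%fset by apply: edges_disjoint.
  have d2 : [disjoint J2 & inner j y']%fset by rewrite /J2 edgesC; apply: edges_disjoint.
  by rewrite fdisjointUX fdisjoint_sym d1 fdisjoint_sym d2.
have dE : depends_on (J1 `|` J2)%fset (fun s => E s s).
  move=> s t st Es; apply: (dE2 t s); last apply: (dE1 s s) => //.
    by move=> e eJ; rewrite st// inE eJ orbT.
  by move=> e eJ; rewrite st// inE eJ.
split; first exact: measurable_event dE.
apply: (conditional_bound indN J1D J2D dJ dE1 dE2) => s.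
have [[gy gy']|ng] := pselect (good n0 s j y /\ good n0 s j y'); last first.
  rewrite (_ : event N _ = set0) ?measure0 ?lee_fin ?expR_ge0//.
  by apply/seteqP; split=> // w [gy gy' _]; apply: ng.
rewrite (_ : event N _ = event N (no_edge (cluster n0 s j y) (cluster n0 s j y'))); last first.
  by apply/seteqP; split=> w; [case|split].
have sub z v : v \in cluster n0 s j z -> v \in block n0 j z.
  by apply/fsubsetP; exact: cluster_block.
rewrite (prob_no_edge mu_ge0 (ltW lam_gt0) N_poisson); last first.
  apply/fdisjointP => u /sub uy; apply/negP => /sub uy'.
  by move/fdisjointP: dB => /(_ u uy); rewrite uy'.
rewrite lee_fin ler_expR lerN2 ler_wpM2l ?(ltW lam_gt0)//.
apply: le_trans (link_rate_ge j) _.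
set m := b%:R ^- _ * _.
have m0 : 0 <= m by rewrite mulr_ge0 ?f_ge0// invr_ge0 exprn_ge0 ?(ltW b_gt0).
(* The lower bound on [ell (v - u)] serves for [f], the upper bound for the power of [b]. *)
have Hm u v : u \in cluster n0 s j y -> v \in cluster n0 s j y' -> m <= mu (v - u).
  move=> /sub uy /sub vy'; have /andP[l1 l2] := block_diff yx y'x yy' uy vy'.
  rewrite /mu /level_measure; apply: ler_pM; rewrite ?f_ge0 ?invr_ge0 ?exprn_ge0 ?(ltW b_gt0)//.
    rewrite lef_pV2 ?posrE ?exprn_gt0// ler_weXn2l ?leq_mul2l//.
    by rewrite ler1n (leq_trans _ hb).
  by apply: f_incr => //; rewrite ler_nat ltnW.
apply: (@le_trans _ _ (\sum_(u <- cluster n0 s j y) \sum_(v <- cluster n0 s j y') m)).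
  rewrite !big_const_seq !count_predT !iter_addr_0 -mulrnA -[leRHS]mulr_natl natrM expr2.
  rewrite ler_wpM2r// mulrC; apply: ler_pM => //; rewrite ler_nat; exact: card_cluster.
rewrite big_seq_cond [leRHS]big_seq_cond; apply: ler_sum => u /andP[uy _].
rewrite big_seq_cond [leRHS]big_seq_cond; apply: ler_sum => v /andP[vy _].
exact: Hm.
Qed.

(** A bad block has two bad sub-blocks, independent since disjoint, or two good ones that are not
    linked. A union bound over ordered pairs and [fail_rec] close the induction. *)
Let prob_bad j x : (P (bad j x) <= (fail j)%:E)%E.
Proof.
elim: j x => [|j IH] x.
  rewrite (_ : bad 0 x = set0).
    by rewrite measure0 lee_fin !divr_ge0 ?invr_ge0 ?exprn_ge0 ?(ltW b_gt0) ?(ltW (width_gt0 _)).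
  by apply/seteqP; split=> // w.
pose Q := [seq (y, y') | y <- subblocks n0 j x, y' <- subblocks n0 j x].
(* The event is made empty off the distinct pairs of [Q], so that it is measurable for every [q]. *)
pose E (q : G * G) : set T :=
  if (q \in Q) && (q.1 != q.2) then (bad j q.1 `&` bad j q.2) `|` unlinked j q.1 q.2 else set0.
have Qmem q : q \in Q -> q.1 \in subblocks n0 j x /\ q.2 \in subblocks n0 j x.
  by move=> /allpairsP[[y y'] /= [yx y'x ->]].
have mE q : measurable (E q).
  rewrite /E; case: ifPn => // /andP[/Qmem[yx y'x] yy'].
  apply: measurableU; first exact: measurableI.
  by have [] := prob_unlinked yx y'x yy'.
have sQ : (size Q)%:R = width j * width j.
  by rewrite size_allpairs size_subblocks// natrM.
apply: (@le_trans _ _ ((size Q)%:R * (fail j ^+ 2 +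
    expR (- (lam * (kappa * width j ^+ 2)))))%:E); last by rewrite sQ lee_fin fail_rec.
apply: (union_bound (E := E)) => //.
- move=> w; rewrite /bad /event /= goodSE negb_and -ltnNge.
  set s := positive N w; set ys := good_subblocks n0 s j x.
  case/orP => [sz|/allPn[y yg /allPn[y' y'g]]].
  + pose zs := [seq y <- subblocks n0 j x | ~~ good n0 s j y].
    have szz : (1 < size zs)%N.
      have : (size ys + size zs = size (subblocks n0 j x))%N.
        by rewrite !size_filter -[RHS](count_predC (good n0 s j)).
      by lia.
    have uz : uniq zs by rewrite filter_uniq// uniq_subblocks.
    case E0 : zs szz uz => [|y [|y' zs']] // _ /=; rewrite inE negb_or => /andP[/andP[yy' _] _].
    have : y \in zs by rewrite E0 mem_head.
    have : y' \in zs by rewrite E0 !inE eqxx orbT.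
    rewrite !mem_filter => /andP[by' y'x] /andP[by_ yx].
    have yQ : (y, y') \in Q by apply/allpairsP; exists (y, y').
    by exists (y, y') => //; rewrite /E yQ /= yy'; left.
  + rewrite negb_or => /andP[yy' nl].
    have [gy yx] : good n0 s j y /\ y \in subblocks n0 j x.
      by move: yg; rewrite mem_filter => /andP[].
    have [gy' y'x] : good n0 s j y' /\ y' \in subblocks n0 j x.
      by move: y'g; rewrite mem_filter => /andP[].
    have yQ : (y, y') \in Q by apply/allpairsP; exists (y, y').
    by exists (y, y') => //; rewrite /E yQ /= yy'; right; split=> //; exact/linkedPn.
- move=> q qQ; have [yx y'x] := Qmem q qQ; rewrite /E qQ /=.
  case: ifPn => [yy'|_]; last first.
    by rewrite measure0 lee_fin addr_ge0 ?expR_ge0 ?sqr_ge0.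
  have [mU PU] := prob_unlinked yx y'x yy'.
  apply: (le_trans (measureU2 _ _ _)) => //; first exact: measurableI.
  rewrite EFinD; apply: leeD => //.
  have dB := block_disjoint yx y'x yy'.
  have PE : (P (bad j q.1 `&` bad j q.2) = P (bad j q.1) * P (bad j q.2))%E.
    apply: (independent_events indN (J1 := inner j q.1) (J2 := inner j q.2)) => //;
      [exact: edges_card2|exact: edges_card2|exact: edges_disjoint].
  have : (P (bad j q.1 `&` bad j q.2) <= (fail j ^+ 2)%:E)%E.
    by rewrite PE expr2 EFinM; apply: lee_pmul.
  by apply: le_trans.
Qed.

(** Some block around 0 is bad with probability at most 1/2; otherwise the clusters around 0 lie in
    one component and their sizes are unbounded. *)
Lemma prob_infinite_component_gt0 :
  P [set w | has_infinite_component (fun e : {fset (Zb_sum b)} => N e w)] != 0%E.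
Proof.
pose A := \bigcup_(j in [set j | (0 <= j)%N]) bad j 0.
have mA : measurable A by exact: bigcup_measurable.
have PA : (P A <= (1 / 2)%:E)%E.
  (* Since [width j >= j.+2 ^+ 2], [fail j] is at most [1 / 2 / (j.+1 * j.+2)], which telescopes. *)
  apply: le_trans (@prob_bigcup_telescope _ _ _ P _ 0 (fun j => 1 / 2 / j.+1%:R) _ _ _) _ => //.
  - move=> j _; apply: le_trans (prob_bad j 0) _; rewrite lee_fin.
    have -> : 1 / 2 / j.+1%:R - 1 / 2 / j.+2%:R = 1 / 2 / (j.+1%:R * j.+2%:R) :> R.
      have j1 : 0 < j.+1%:R :> R by [].
      rewrite -[j.+2%:R]natr1; move: (j.+1%:R) j1 => x x0; field.
      by rewrite !gt_eqF// addr_gt0.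
    apply: ler_pM; rewrite ?divr_ge0 ?invr_ge0 ?exprn_ge0 ?(ltW b_gt0) ?(ltW (width_gt0 _))//.
      rewrite ler_wpM2r// invf_le1 ?exprn_gt0// exprn_ege1// ler1n.
      exact: leq_trans hb.
    rewrite lef_pV2 ?posrE ?mulr_gt0 ?exprn_gt0//.
    have w1 := width_ge1 j; have w2 := width_ge j.
    apply: (@le_trans _ _ (width j)); last first.
      by rewrite exprS ler_peMr ?(ltW (width_gt0 _))// exprn_ege1.
    by apply: le_trans w2; rewrite expr2 ler_wpM2r// ler_nat.
  - by rewrite divr1.
apply/eqP => P0.
have : (P (~` A) <= 0)%E.
  rewrite -P0; apply: le_measure; rewrite ?inE.
  - exact: measurableC.
  - exact: measurable_infinite_component.
  move=> w nA; pose s := positive N w.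
  have gs i : good n0 s i 0.
    by apply: contrapT => /negP gi; apply: nA; exists i.
  exists 0 => /finite_fsetP[V V0].
  have cl j : (cluster n0 s j 0 `<=` V)%fset.
    apply/fsubsetP => v vj; suff : [set` V] v by [].
    rewrite -V0; apply: (@cluster_connected _ _ _ j 0); last exact: vj.
      exact: gs.
    exact: good_nested gs.
  have sizes j : (cluster_size b j <= #|` V|)%N.
    by apply: leq_trans (card_cluster hb (gs j)) _; exact: fsubset_leq_card (cl j).
  (* At this scale the cluster has at least [b ^ j / 2 >= (j + 1) / 2] points, more than [V] has. *)
  pose j := (2 * #|` V|)%N.
  have : (j.+1%:R <= 2 * (cluster_size b j)%:R :> R).
    rewrite -ler_pdivrMl// mulrC; apply: le_trans (cluster_size_ge j).
    rewrite ler_wpM2r// -expfB_cond ?gt_eqF//; last first.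
      by rewrite (leq_trans _ (level_ge j))// leq_addr.
    apply: (@le_trans _ _ (b%:R ^+ j)).
      by rewrite -natrX ler_nat ltn_expl.
    rewrite ler_weXn2l ?ler1n ?(leq_trans _ hb)//.
    by have := level_ge j; lia.
  rewrite -natrM ler_nat; have := sizes j; rewrite /j; lia.
rewrite probability_setC// -(@leeD2rE _ (P A)) ?fin_num_measure//.
by rewrite subeK ?fin_num_measure// add0e => /le_trans /(_ PA); rewrite lee_fin; lra.
Qed.

End percolation.

(** * The growth hypothesis of (a), and the theorem *)

Lemma Omega_pow (R : realType) (b : nat) (f : R -> R) (a : R) : 1 < a ->
  is_Omega f (fun l => a `^ Num.sqrt l) ->
  exists n0 : nat, forall l : nat, (n0 <= l)%N -> (b * l.+2)%:R ^+ 8 <= f l%:R.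
Proof.
move=> a1; rewrite /is_Omega limf_einfE => /ereal_sup_gt[_ [V [M [_ MV]] <-]] V0.
set g := fun x => a `^ Num.sqrt x in V0.
(* The positive infimum over [V] is a real number because [V] contains [M + 1]. *)
have [c c0 Hc] : exists2 c : R, 0 < c & forall x, V x -> c <= f x / g x.
  set m := ereal_inf _ in V0.
  have mV x : V x -> (m <= (f x / g x)%:E)%E by move=> Vx; apply: ereal_inf_lbound; exists x.
  have VM : V (M + 1) by apply: MV; rewrite ltrDl.
  have := mV _ VM; move: V0 mV; case: m => // c.
  by rewrite lte_fin => c0 mV _; exists c => // x /mV; rewrite lee_fin.
pose L := ln a.
have L0 : 0 < L by apply: ln_gt0.
pose A : R := c * (L / 18) ^+ 18.
have A0 : 0 < A by rewrite mulr_gt0// exprn_gt0// divr_gt0.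
pose B := (2 * b%:R) ^+ 8 / A : R.
(* The shift by 2 gives both [l > max M B] and [l >= 2]; the latter yields [l.+2 <= 2 * l]. *)
pose n0 := (Num.truncn (Num.max M B)).+2.
exists n0 => l n0l.
have lMB : Num.max M B < l%:R.
  apply: lt_le_trans (truncnS_gt _) _; rewrite ler_nat; exact: ltnW n0l.
have Ml : M < l%:R by apply: le_lt_trans lMB; rewrite le_max lexx.
have Bl : B < l%:R by apply: le_lt_trans lMB; rewrite le_max lexx orbT.
have l2 : (2 <= l)%N by rewrite (leq_trans _ n0l).
have := Hc _ (MV _ Ml).
have g0 : 0 < g l%:R by rewrite powR_gt0// (lt_trans _ a1).
rewrite ler_pdivlMr// => /(le_trans _); apply.
(* Write [g l = expR (s / 18) ^+ 18] with [s = sqrt l * ln a] and use [expR x >= x]: the result is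
   of order [l ^+ 9], whose spare power of [l] absorbs the constants. *)
have gE : (L / 18) ^+ 18 * l%:R ^+ 9 <= g l%:R.
  have -> : g l%:R = expR (Num.sqrt l%:R * L / 18) ^+ 18.
    rewrite -expRM_natr /g /powR gt_eqF ?(lt_trans _ a1)//; congr expR.
    by rewrite -/L; field.
  have -> : (L / 18) ^+ 18 * l%:R ^+ 9 = (Num.sqrt l%:R * L / 18) ^+ 18 :> R.
    rewrite -{1}(sqr_sqrtr (ler0n R l)) -exprM -exprMn.
    by congr (_ ^+ 18); ring.
  have s0 : 0 <= Num.sqrt l%:R * L / 18 :> R.
    by rewrite divr_ge0 ?mulr_ge0 ?sqrtr_ge0 ?(ltW L0).
  rewrite lerXn2r ?nnegrE ?expR_ge0//.
  by have := expR_ge1Dx (Num.sqrt l%:R * L / 18); lra.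
apply: le_trans (ler_wpM2l (ltW c0) gE); rewrite mulrA -/A.
apply: (@le_trans _ _ ((2 * b%:R * l%:R) ^+ 8)).
  rewrite lerXn2r ?nnegrE ?mulr_ge0// natrM -mulrA mulrCA ler_wpM2l//.
  by rewrite -natrM ler_nat; lia.
have -> : (2 * b%:R * l%:R) ^+ 8 = (2 * b%:R) ^+ 8 * l%:R ^+ 8 :> R by rewrite exprMn.
have -> : A * l%:R ^+ 9 = A * l%:R * l%:R ^+ 8 by rewrite -mulrA -exprS.
apply: ler_wpM2r; first by rewrite exprn_ge0.
by rewrite [A * _]mulrC ltW// -ltr_pdivrMr.
Qed.

Theorem theorem4p2 (R : realType) (b : nat) (hb : (2 <= b)%N) (f : R -> R)
    (f_ge0 : forall x : R, 0 <= x -> 0 <= f x)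
    (f_incr : forall x y : R, 0 <= x -> x <= y -> f x <= f y)
    (mu_finite : finite_mass (@level_measure R b f))
    (mu_gen : support_generates (@level_measure R b f)) :
  ((exists2 a : R, 1 < a & is_Omega f (fun l => a `^ Num.sqrt l)) ->
     (lambda_c (@level_measure R b f) < +oo)%E) /\
  (is_little_o f (fun l => ln l) -> ultimately_concave f ->
     lambda_c (@level_measure R b f) = +oo%E).
Proof.
split=> [[a a1 fa]|fo _].
  have [n0 f_large] := Omega_pow b a1 fa.
  pose lam0 : R := 96 * b%:R ^+ 16 * b%:R ^+ (2 * n0).
  rewrite /lambda_c gt_max ltry /=.
  apply: (@le_lt_trans _ _ lam0%:E); last exact: ltry.
  apply: ge_ereal_sup => _ [lam [lam_gt0 no_inf] <-].
  rewrite lee_fin leNgt; apply/negP => lam_large.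
  (* A realisation must exist here, for otherwise [as_no_infinite_component] would hold
     vacuously. *)
  have [d [T [P [N NP]]]] :=
    exists_poisson_multigraph lam (@level_measure_sym R b f).
  have /eqP := prob_infinite_component_gt0 hb f_ge0 f_incr f_large (ltW lam_large) NP.
  by apply; exact: no_inf NP.
suff sup_y : ereal_sup [set lam%:E | lam in [set lam : R | 0 < lam /\
    as_no_infinite_component (@level_measure R b f) lam]] = +oo%E.
  by rewrite /lambda_c sup_y; apply/eqP; rewrite -leye_eq le_max lexx orbT.
apply/eqyP => A A0; apply: ereal_sup_ubound; exists A => //.
split=> // d T P N NP; exact: (prob_infinite_component0 hb A0 f_ge0 f_incr fo NP).
Qed.
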